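(* Let $Q$ be the cyclic quiver on $n$ vertices with cyclic orientation, let $M=(V,\rho)$ be a nilpotent representation of $Q$ over $k$ and put $\mathbf d=\dim V$. Then for all compositions $\underline{\mathbf d}\in\mathrm{Comp}(\mathbf d)$, the (partial) quiver flag variety $\mathrm{Fl}(M,\underline{\mathbf d})$ admits an affine paving.
   Context: $k=\overline{\mathbb F}_p$. $Q_0=Q_1=\mathbb Z/n$, where arrow $i$ goes from vertex $i$ to vertex $i+1$. A representation $M=(V,\rho)$ consists of a finite-dimensional $Q_0$-graded $k$-vector space $V=(V_i)$ and linear maps $\rho_i:V_i\to V_{i+1}$; its dimension vector is $\dim V=(\dim V_i)_{i\in Q_0}$. $M$ is nilpotent if there is $N\ge0$ such that the composition of $\rho$ along any $N$ composable arrows is $0$. A composition of $\mathbf d$ is a tuple $\underline{\mathbf d}=(\underline{\mathbf d}^1,\dots,\underline{\mathbf d}^{m})$ of nonzero vectors in $\mathbb Z_{\ge0}Q_0$ summing to $\mathbf d$; $\mathrm{Comp}(\mathbf d)$ is the set of these. $\mathrm{Fl}(M,\underline{\mathbf d})$ is the variety of flags $0=V^0\subset V^1\subset\dots\subset V^{m}=V$ of $Q_0$-graded subspaces with $\dim V^j/V^{j-1}=\underline{\mathbf d}^j$ which are strictly $\rho$-stable: $\rho_i(V^j_{i})\subset V^{j-1}_{i+1}$ for all $j=1,\dots,m$ and $i\in\mathbb Z/n$. An affine paving of a variety $X$ is a partition of $X$ into subvarieties $X_1,\dots,X_r$ such that $X_1\cup\dots\cup X_l$ is closed in $X$ for all $1\le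 l\le r$ and each $X_i$ is isomorphic to an affine space $\mathbb A^{m_i}$. *)

(* Defs.v *)
From HB Require Import structures.
From mathcomp Require Import all_boot all_order all_algebra all_field.
From mathcomp Require Import boolp classical_sets.
From mathcomp Require Import mpoly.

Set Implicit Arguments.
Unset Strict Implicit.
Unset Printing Implicit Defensive.

Import GRing.Theory.
Local Open Scope classical_set_scope.
Local Open Scope ring_scope.

(* [k] is an algebraic closure of F_p via [iota]; algebraic closedness is part
   of the type of [k].  (For [p] prime, 'F_p is Z/p.) *)
Definition alg_closure_of_Fp (p : nat) (k : closedFieldType)
    (iota : {rmorphism 'F_p -> k}) : Prop :=
  prime p /\ forall x : k, algebraicOver iota x.

(** * Varieties as spaces with functions *)

(* A topological space with a sheaf of k-valued functions containing the
   constants, closed under ring operations and under inversion on the (open)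
   nonvanishing locus.  Since functions in Rocq are total, [regular U f] concerns
   only the restriction of [f] to [U] (axiom [regular_ext]) and is meaningful
   for open [U]. *)
Record fspace (k : fieldType) : Type := FSpace {
  carrier :> Type;
  fopen : set carrier -> Prop;
  regular : set carrier -> (carrier -> k) -> Prop;
  fopenT : fopen setT;
  fopenI : forall U W, fopen U -> fopen W -> fopen (U `&` W);
  fopen_bigcup : forall (I : Type) (D : set I) (U : I -> set carrier),
    (forall i, D i -> fopen (U i)) -> fopen (\bigcup_(i in D) U i);
  regular_ext : forall U f g,
    (forall x, U x -> f x = g x) -> regular U f -> regular U g;
  regular_sub : forall U W f,
    fopen U -> fopen W -> W `<=` U -> regular U f -> regular W f;
  regular_local : forall U f, fopen U ->
    (forall x, U x -> exists W, [/\ fopen W, W x, W `<=` U & regular W f]) ->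
    regular U f;
  regular_cst : forall U (a : k), fopen U -> regular U (fun=> a);
  regularD : forall U f g, fopen U ->
    regular U f -> regular U g -> regular U (fun x => f x + g x);
  regularM : forall U f g, fopen U ->
    regular U f -> regular U g -> regular U (fun x => f x * g x);
  regularV : forall U f, fopen U -> regular U f ->
    fopen [set x | U x /\ f x != 0] /\
    regular [set x | U x /\ f x != 0] (fun x => (f x)^-1)
}.

Definition fclosed (k : fieldType) (X : fspace k) (Z : set X) : Prop :=
  fopen (~` Z).

Definition locally_closed (k : fieldType) (X : fspace k) (Z : set X) : Prop :=
  exists U C : set X, [/\ fopen U, fclosed C & Z = U `&` C].

Definition morphism (k : fieldType) (X Y : fspace k) (phi : X -> Y) : Prop :=
  forall U : set Y, fopen U ->
    fopen (phi @^-1` U) /\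
    forall f, regular U f -> regular (phi @^-1` U) (f \o phi).

Definition isomorphic (k : fieldType) (X Y : fspace k) : Prop :=
  exists (phi : X -> Y) (psi : Y -> X),
    [/\ morphism phi, morphism psi, cancel phi psi & cancel psi phi].

(** ** Sets with coordinates: the structure induced from affine N-space *)
Section Zariski.
Variables (k : fieldType) (X : Type) (N : nat) (c : X -> 'I_N -> k).

Definition zopen (U : set X) : Prop :=
  forall x, U x -> exists s : {mpoly k[N]},
    s.@[c x] != 0 /\ forall y, s.@[c y] != 0 -> U y.

Definition zregular (U : set X) (f : X -> k) : Prop :=
  forall x, U x -> exists a b : {mpoly k[N]},
    b.@[c x] != 0 /\
    forall y, U y -> b.@[c y] != 0 -> f y = a.@[c y] / b.@[c y].

Fact zopenT : zopen setT.
Proof. by move=> x _; exists 1; rewrite meval1 oner_neq0. Qed.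

Fact zopenI U W : zopen U -> zopen W -> zopen (U `&` W).
Proof.
move=> oU oW x [/oU[s [sx sU]] /oW[t [tx tW]]]; exists (s * t).
rewrite mevalM mulf_neq0 //; split=> // y.
by rewrite mevalM mulf_eq0 negb_or => /andP[/sU ? /tW].
Qed.

Fact zopen_bigcup (I : Type) (D : set I) (U : I -> set X) :
  (forall i, D i -> zopen (U i)) -> zopen (\bigcup_(i in D) U i).
Proof.
move=> oU x [i Di /(oU i Di)[s [sx sU]]]; exists s; split=> // y /sU Uy.
by exists i.
Qed.

Fact zregular_ext U f g :
  (forall x, U x -> f x = g x) -> zregular U f -> zregular U g.
Proof.
move=> fg rf x /rf[a [b [bx ab]]]; exists a, b; split=> // y Uy /(ab y Uy).
by rewrite fg.
Qed.

Fact zregular_sub U W f :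
  zopen U -> zopen W -> W `<=` U -> zregular U f -> zregular W f.
Proof.
move=> _ _ WU rf x /WU /rf[a [b [bx ab]]]; exists a, b; split=> // y /WU.
exact: ab.
Qed.

Fact zregular_local U f : zopen U ->
  (forall x, U x -> exists W, [/\ zopen W, W x, W `<=` U & zregular W f]) ->
  zregular U f.
Proof.
move=> _ loc x /loc[W [oW Wx WU rf]].
have [a [b [bx ab]]] := rf x Wx; have [s [sx sW]] := oW x Wx.
exists (a * s), (b * s); rewrite mevalM mulf_neq0 //; split=> // y Uy.
rewrite !mevalM mulf_eq0 negb_or => /andP[by0 sy0].
by rewrite -mulf_div divff // mulr1; apply: ab => //; apply: sW.
Qed.

Fact zregular_cst U (a : k) : zopen U -> zregular U (fun=> a).
Proof.
move=> _ x _; exists a%:MP, 1; rewrite meval1 oner_neq0; split=> // y _ _.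
by rewrite meval1 mevalC divr1.
Qed.

Fact zregularD U f g : zopen U ->
  zregular U f -> zregular U g -> zregular U (fun x => f x + g x).
Proof.
move=> _ rf rg x Ux; have [a [b [bx ab]]] := rf x Ux.
have [a' [b' [bx' ab']]] := rg x Ux.
exists (a * b' + a' * b), (b * b'); rewrite mevalM mulf_neq0 //; split=> // y Uy.
rewrite mevalD !mevalM mulf_eq0 negb_or => /andP[by0 by0'].
by rewrite ab // ab' // addf_div.
Qed.

Fact zregularM U f g : zopen U ->
  zregular U f -> zregular U g -> zregular U (fun x => f x * g x).
Proof.
move=> _ rf rg x Ux; have [a [b [bx ab]]] := rf x Ux.
have [a' [b' [bx' ab']]] := rg x Ux.
exists (a * a'), (b * b'); rewrite mevalM mulf_neq0 //; split=> // y Uy.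
rewrite !mevalM mulf_eq0 negb_or => /andP[by0 by0'].
by rewrite ab // ab' // mulf_div.
Qed.

Fact zregularV U f : zopen U -> zregular U f ->
  zopen [set x | U x /\ f x != 0] /\
  zregular [set x | U x /\ f x != 0] (fun x => (f x)^-1).
Proof.
move=> oU rf; split=> x [Ux fx0]; have [a [b [bx ab]]] := rf x Ux.
  have [s [sx sU]] := oU x Ux; exists (s * (a * b)).
  have ax : a.@[c x] != 0.
    by apply: contra_neq fx0 => ax; rewrite ab // ax mul0r.
  rewrite !mevalM !mulf_neq0 //; split=> // y.
  rewrite !mevalM !mulf_eq0 !negb_or => /and3P[/sU Uy ay by0].
  by split=> //; rewrite ab // mulf_neq0 ?invr_eq0.
have ax : a.@[c x] != 0 by apply: contra_neq fx0 => ax; rewrite ab // ax mul0r.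
exists (b * b), (a * b); rewrite mevalM mulf_neq0 //; split=> // y [Uy _].
rewrite !mevalM mulf_eq0 negb_or => /andP[ay by0].
by rewrite ab // invf_div -mulf_div divff // mulr1.
Qed.

Definition zariski : fspace k :=
  FSpace zopenT zopenI zopen_bigcup zregular_ext zregular_sub zregular_local
    zregular_cst zregularD zregularM zregularV.

End Zariski.

Definition affine_space (k : fieldType) (m : nat) : fspace k :=
  zariski (fun (x : 'rV[k]_m) (a : 'I_m) => x 0 a).

(** ** Subspaces *)
Section Subspace.
Variables (k : fieldType) (X : fspace k) (A : set X).

Definition sopen (U : set (set_type A)) : Prop :=
  exists2 W : set X, fopen W & U = [set x | W (\val x)].

Definition sregular (U : set (set_type A)) (f : set_type A -> k) : Prop :=
  forall x, U x -> exists (W : set X) (g : X -> k),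
    [/\ fopen W, W (\val x), regular W g &
        forall y, U y -> W (\val y) -> f y = g (\val y)].

Fact sopenT : sopen setT.
Proof. by exists setT => //; exact: fopenT. Qed.

Fact sopenI U W : sopen U -> sopen W -> sopen (U `&` W).
Proof.
by move=> [U' oU ->] [W' oW ->]; exists (U' `&` W') => //; exact: fopenI.
Qed.

Fact sopen_bigcup (I : Type) (D : set I) (U : I -> set (set_type A)) :
  (forall i, D i -> sopen (U i)) -> sopen (\bigcup_(i in D) U i).
Proof.
move=> oU.
pose E := [set W : set X | fopen W /\
  exists2 i, D i & U i = [set x | W (\val x)]].
exists (\bigcup_(W in E) W); first by apply: fopen_bigcup => W [].
apply/seteqP; split=> x.
  move=> [i Di]; have [W oW UW] := oU i Di; rewrite UW => Wx.
  by exists W => //; split=> //; exists i.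
by move=> [W [oW [i Di UW]] Wx]; exists i => //; rewrite UW.
Qed.

Fact sregular_ext U f g :
  (forall x, U x -> f x = g x) -> sregular U f -> sregular U g.
Proof.
move=> fg rf x /rf[W [h [oW Wx rh e]]]; exists W, h; split=> // y Uy /(e y Uy).
by rewrite fg.
Qed.

Fact sregular_sub U W f :
  sopen U -> sopen W -> W `<=` U -> sregular U f -> sregular W f.
Proof.
move=> _ _ WU rf x /WU /rf[W' [h [oW' Wx rh e]]]; exists W', h; split=> // y /WU.
exact: e.
Qed.

Fact sregular_local U f : sopen U ->
  (forall x, U x -> exists W, [/\ sopen W, W x, W `<=` U & sregular W f]) ->
  sregular U f.
Proof.
move=> _ loc x /loc[_ [[W oW ->] /= Wx WU rf]].
have [W' [h [oW' Wx' rh e]]] := rf x Wx.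
have oI := fopenI oW oW'.
exists (W `&` W'), h; split=> //.
  exact: regular_sub oW' oI (@subIsetr _ W W') rh.
by move=> y Uy [Wy Wy']; apply: e.
Qed.

Fact sregular_cst U (a : k) : sopen U -> sregular U (fun=> a).
Proof.
move=> _ x _; exists setT, (fun=> a); split=> //; first exact: fopenT.
by apply: regular_cst; exact: fopenT.
Qed.

Fact sregularD U f g : sopen U ->
  sregular U f -> sregular U g -> sregular U (fun x => f x + g x).
Proof.
move=> _ rf rg x Ux; have [W [h [oW Wx rh e]]] := rf x Ux.
have [W' [h' [oW' Wx' rh' e']]] := rg x Ux.
have oI := fopenI oW oW'.
exists (W `&` W'), (fun x => h x + h' x); split=> //.
  apply: regularD => //; first exact: regular_sub oW oI (@subIsetl _ W W') rh.
  exact: regular_sub oW' oI (@subIsetr _ W W') rh'.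
by move=> y Uy [Wy Wy']; rewrite e // e'.
Qed.

Fact sregularM U f g : sopen U ->
  sregular U f -> sregular U g -> sregular U (fun x => f x * g x).
Proof.
move=> _ rf rg x Ux; have [W [h [oW Wx rh e]]] := rf x Ux.
have [W' [h' [oW' Wx' rh' e']]] := rg x Ux.
have oI := fopenI oW oW'.
exists (W `&` W'), (fun x => h x * h' x); split=> //.
  apply: regularM => //; first exact: regular_sub oW oI (@subIsetl _ W W') rh.
  exact: regular_sub oW' oI (@subIsetr _ W W') rh'.
by move=> y Uy [Wy Wy']; rewrite e // e'.
Qed.

Fact sregularV U f : sopen U -> sregular U f ->
  sopen [set x | U x /\ f x != 0] /\
  sregular [set x | U x /\ f x != 0] (fun x => (f x)^-1).
Proof.
move=> [V oV ->] rf; split; last first.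
  move=> x [Ux fx]; have [W [h [oW Wx rh e]]] := rf x Ux.
  have [oN rN] := regularV oW rh.
  exists [set x | W x /\ h x != 0], (fun x => (h x)^-1); split=> //=.
    by rewrite -e.
  by move=> y [Uy fy] [Wy _]; rewrite e.
pose E := [set W : set X | fopen W /\
  forall y : set_type A, W (\val y) -> V (\val y) /\ f y != 0].
exists (\bigcup_(W in E) W); first by apply: fopen_bigcup => W [].
apply/seteqP; split=> x; last by move=> [W [_ WV] /WV].
move=> [Vx fx]; have [W [h [oW Wx rh e]]] := rf x Vx.
have oVW := fopenI oV oW; have [oN _] := regularV oW rh.
exists (V `&` [set x | W x /\ h x != 0]); last first.
  by split=> //; split=> //; rewrite -e.
split; first exact: fopenI.
by move=> y [Vy [Wy hy]]; rewrite e.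
Qed.

Definition subspace : fspace k :=
  FSpace sopenT sopenI sopen_bigcup sregular_ext sregular_sub sregular_local
    sregular_cst sregularD sregularM sregularV.

End Subspace.

(** ** Quotients *)
Section Quotient.
Variables (k : fieldType) (X : fspace k) (Y : Type) (pi : X -> Y).

Definition qopen (U : set Y) : Prop := fopen (pi @^-1` U).

Definition qregular (U : set Y) (f : Y -> k) : Prop :=
  regular (pi @^-1` U) (f \o pi).

Fact qopenT : qopen setT.
Proof. exact: fopenT. Qed.

Fact qopenI U W : qopen U -> qopen W -> qopen (U `&` W).
Proof. exact: fopenI. Qed.

Fact qopen_bigcup (I : Type) (D : set I) (U : I -> set Y) :
  (forall i, D i -> qopen (U i)) -> qopen (\bigcup_(i in D) U i).
Proof. by move=> oU; rewrite /qopen preimage_bigcup; apply: fopen_bigcup. Qed.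

Fact qregular_ext U f g :
  (forall x, U x -> f x = g x) -> qregular U f -> qregular U g.
Proof. by move=> fg; apply: regular_ext => x Ux; apply: fg. Qed.

Fact qregular_sub U W f :
  qopen U -> qopen W -> W `<=` U -> qregular U f -> qregular W f.
Proof. by move=> oU oW WU; apply: regular_sub => // x /WU. Qed.

Fact qregular_local U f : qopen U ->
  (forall x, U x -> exists W, [/\ qopen W, W x, W `<=` U & qregular W f]) ->
  qregular U f.
Proof.
move=> oU loc; apply: regular_local => // x /loc[W [oW Wx WU rW]].
by exists (pi @^-1` W); split=> // y /WU.
Qed.

Fact qregular_cst U (a : k) : qopen U -> qregular U (fun=> a).
Proof. exact: regular_cst. Qed.

Fact qregularD U f g : qopen U ->
  qregular U f -> qregular U g -> qregular U (fun x => f x + g x).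
Proof. exact: regularD. Qed.

Fact qregularM U f g : qopen U ->
  qregular U f -> qregular U g -> qregular U (fun x => f x * g x).
Proof. exact: regularM. Qed.

Fact qregularV U f : qopen U -> qregular U f ->
  qopen [set x | U x /\ f x != 0] /\
  qregular [set x | U x /\ f x != 0] (fun x => (f x)^-1).
Proof. exact: regularV. Qed.

Definition quotient_space : fspace k :=
  FSpace qopenT qopenI qopen_bigcup qregular_ext qregular_sub qregular_local
    qregular_cst qregularD qregularM qregularV.

End Quotient.

(** ** Affine pavings *)
Definition affine_paving (k : fieldType) (X : fspace k) : Prop :=
  exists (r : nat) (P : 'I_r -> set X),
    [/\ forall x : X, exists! i, P i x,
        forall i, locally_closed (P i),
        forall l : 'I_r, fclosed (\bigcup_(i in [set i : 'I_r | (i <= l)%N]) P i) &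
        forall i, exists m : nat, isomorphic (subspace (P i)) (affine_space k m)].

(** * Representations of the cyclic quiver *)

(* The vertex set Z/n is ['I_n] with cyclic successor [ordS]. *)
Record cyclic_rep (k : fieldType) (n : nat) : Type := CyclicRep {
  rspace : 'I_n -> vectType k;
  rmap : forall i, 'Hom(rspace i, rspace (ordS i))
}.

Definition dimvec (k : fieldType) (n : nat) (V : 'I_n -> vectType k)
  : {ffun 'I_n -> nat} := [ffun i => \dim {: V i}].

Fixpoint rpath (k : fieldType) (n : nat) (M : cyclic_rep k n) (N : nat)
    (i : 'I_n) : 'Hom(rspace M i, rspace M (iter N (@ordS n) i)) :=
  match N with
  | 0 => \1%VF
  | N'.+1 => (rmap M (iter N' (@ordS n) i) \o rpath M N' i)%VF
  end.

Definition nilpotent_rep (k : fieldType) (n : nat) (M : cyclic_rep k n) : Prop :=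
  exists N : nat, forall i : 'I_n, rpath M N i = 0.

Record composition (n : nat) (d : {ffun 'I_n -> nat}) : Type := Composition {
  clen : nat;
  cpart :> 'I_clen -> {ffun 'I_n -> nat};
  cpart_neq0 : forall j, cpart j != 0;
  cpart_sum : \sum_j cpart j = d
}.

(** * Partial flag varieties *)
Section Flags.
Variables (k : fieldType) (n : nat) (V : 'I_n -> vectType k).
Variable (dd : composition (dimvec V)).
Let m := clen dd.

(* [F j] is the j-th step of the flag, 0 <= j <= m; for [j : 'I_m] the steps
   j and j+1 are [widen_ord (leqnSn m) j] and [lift ord0 j], and [dd j] is the
   dimension vector of step j+1 modulo step j. *)
Definition is_flag (F : 'I_m.+1 -> forall i, {vspace V i}) : Prop :=
  [/\ forall i, F ord0 i = 0%VS,
      forall i, F ord_max i = fullv,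
      forall (j : 'I_m) i, (F (widen_ord (leqnSn m) j) i <= F (lift ord0 j) i)%VS &
      forall (j : 'I_m) i,
        \dim (F (lift ord0 j) i) = (\dim (F (widen_ord (leqnSn m) j) i) + dd j i)%N].

Definition gflag : Type := set_type is_flag.

(* A graded frame: an ordered basis of every [V i]. *)
Definition frame : Type :=
  {e : forall i, (\dim {: V i}).-tuple (V i) |
    [forall i, basis_of fullv (e i)]}.

(* The frames form the group \prod_i GL(V_i), an open subset of the affine
   space of all families of square matrices. *)
Definition frame_coord (e : frame)
    (a : 'I_#|{: {i : 'I_n & ('I_(\dim {: V i}) * 'I_(\dim {: V i}))%type}}|) : k :=
  let: existT i (b, l) := enum_val a in
  coord (vbasis fullv) l (tnth (\val e i) b).

Definition frame_space : fspace k := zariski frame_coord.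

Definition partial_dim (j : nat) (i : 'I_n) : nat :=
  \sum_(l < m | (l < j)%N) dd l i.

Definition frame_flag_fun (e : frame) (j : 'I_m.+1) (i : 'I_n) : {vspace V i} :=
  <<take (partial_dim j i) (\val e i)>>%VS.

Lemma frame_flagP (e : frame) : is_flag (frame_flag_fun e).
Proof.
have bas i : basis_of fullv (\val e i) by have /forallP := valP e; apply.
have fr i : free (\val e i) by apply: basis_free (bas i).
have sz i : size (\val e i) = partial_dim m i.
  rewrite size_tuple.
  have := congr1 (fun f : {ffun 'I_n -> nat} => f i) (cpart_sum dd).
  rewrite ffunE sum_ffunE /partial_dim => <-.
  by apply: eq_bigl => l; rewrite ltn_ord.
have leP j j' i : (j <= j')%N -> (partial_dim j i <= partial_dim j' i)%N.
  move=> jj'; rewrite /partial_dim big_mkcond [X in (_ <= X)%N]big_mkcond.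
  by apply: leq_sum => l _; case: ifP => // lj; rewrite (leq_trans lj jj').
have stepP (j : 'I_m) i :
    partial_dim j.+1 i = (partial_dim j i + dd j i)%N.
  rewrite /partial_dim (bigD1 j) //= addnC; congr (_ + _)%N; apply: eq_bigl => l.
  by rewrite ltnS -val_eqE /= ltn_neqAle andbC.
have dimP (j : 'I_m.+1) i : \dim (frame_flag_fun e j i) = partial_dim j i.
  rewrite /frame_flag_fun (eqnP (_ : free _)).
    by rewrite size_takel // sz leP // -ltnS.
  by have := fr i; rewrite -{1}(cat_take_drop (partial_dim j i) (\val e i));
     exact: catl_free.
split.
- by move=> i; apply/eqP; rewrite -dimv_eq0 dimP /partial_dim big_pred0.
- move=> i; rewrite /frame_flag_fun -sz take_size.
  by have /andP[/eqP] := bas i.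
- move=> j i; apply: sub_span => v.
  have -> : take (partial_dim (widen_ord (leqnSn m) j) i) (\val e i) =
    take (partial_dim j i) (take (partial_dim (lift ord0 j) i) (\val e i)).
    by rewrite take_takel // leP //= /bump /= ltnW.
  exact: mem_take.
- by move=> j i; rewrite !dimP -stepP.
Qed.

Definition frame_flag (e : frame) : gflag :=
  SigSub (mem_set (frame_flagP e)).

Lemma frame_flag_surj (F : gflag) : exists e : frame, frame_flag e = F.
Proof.
have [F0 FT Fsub Fdim] : is_flag (\val F) by have := valP F; rewrite in_setE.
have wE (j : 'I_m) : widen_ord (leqnSn m) j = inord j.
  by apply: val_inj; rewrite /= inordK // ltnS ltnW.
have lE (j : 'I_m) : lift ord0 j = inord j.+1.
  by apply: val_inj; rewrite /= inordK // ltnS.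
have build i j : (j <= m)%N -> exists s : seq (V i), [/\ free s,
    size s = partial_dim j i &
    forall j', (j' <= j)%N ->
      <<take (partial_dim j' i) s>>%VS = \val F (inord j') i].
  elim: j => [_|j IHj jm].
    exists [::]; split; first exact: nil_free.
      by rewrite /partial_dim big_pred0.
    move=> j'; rewrite leqn0 => /eqP->; rewrite span_nil.
    by rewrite (_ : inord 0 = ord0) ?F0 //; apply: val_inj; rewrite /= inordK.
  have [s [frs szs sP]] := IHj (ltnW jm); pose J := Ordinal jm.
  have := Fsub J i; have := Fdim J i; rewrite wE lE /= => dJ sJ.
  have Fj : <<s>>%VS = \val F (inord j) i.
    by rewrite -(sP j) // -szs take_size.
  have dFj : \dim (\val F (inord j) i) = partial_dim j i.
    by rewrite -Fj (eqnP frs).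
  have pdS : partial_dim j.+1 i = (partial_dim j i + dd J i)%N.
    rewrite /partial_dim (bigD1 J) //= addnC; congr (_ + _)%N.
    by apply: eq_bigl => l; rewrite ltnS -val_eqE /= ltn_neqAle andbC.
  pose t := vbasis (\val F (inord j.+1) i :\: \val F (inord j) i)%VS.
  have Fj1 : <<s ++ t>>%VS = \val F (inord j.+1) i.
    rewrite span_cat Fj (span_basis (vbasisP _)) addvC.
    by rewrite -{2}(addv_diff_cap (\val F (inord j.+1) i) (\val F (inord j) i));
       rewrite (capv_idPr sJ).
  have sz1 : size (s ++ t) = partial_dim j.+1 i.
    rewrite size_cat szs size_tuple.
    have := dimv_cap_compl (\val F (inord j.+1) i) (\val F (inord j) i).
    by rewrite (capv_idPr sJ) dJ pdS => /addnI ->.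
  exists (s ++ t); split=> //.
    by rewrite /free Fj1 dJ sz1 pdS dFj.
  move=> j'; rewrite leq_eqVlt => /predU1P[->|j'j].
    by rewrite -sz1 take_size.
  rewrite takel_cat ?sP // szs /partial_dim big_mkcond [leqRHS]big_mkcond.
  by apply: leq_sum => l _; case: ifP => // /leq_trans -> //.
have fullP i : exists s : (\dim {: V i}).-tuple (V i), basis_of fullv s /\
    forall j : 'I_m.+1, <<take (partial_dim j i) s>>%VS = \val F j i.
  have [s [frs szs sP]] := build i m (leqnn m).
  have sT : <<s>>%VS = fullv.
    rewrite -(FT i) -[s]take_size szs sP //; congr (\val F _ i).
    by apply: val_inj; rewrite /= inordK.
  have sz : size s == \dim {: V i} by rewrite -sT (eqnP frs).
  exists (Tuple sz); split; first by rewrite basisEfree frs sT subvv (eqP sz) leqnn.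
  by move=> j; rewrite /= sP ?inord_val // -ltnS.
pose e i := projT1 (cid (fullP i)).
have eB : [forall i, basis_of fullv (e i)].
  by apply/forallP => i; rewrite /e; case: (cid _) => s [].
exists (exist _ e eB); apply: val_inj; apply/funext => j.
apply: functional_extensionality_dep => i /=.
by rewrite /frame_flag_fun /= /e; case: (cid _) => s [].
Qed.

(* The variety of all graded flags of type [dd], as the homogeneous space
   (\prod_i GL(V_i)) / P. *)
Definition flag_variety : fspace k := quotient_space (X := frame_space) frame_flag.

End Flags.

Definition strictly_stable (k : fieldType) (n : nat) (M : cyclic_rep k n)
    (dd : composition (dimvec (rspace M))) (F : flag_variety dd) : Prop :=
  forall (j : 'I_(clen dd)) (i : 'I_n),
    (rmap M i @: \val F (lift ord0 j) i
       <= \val F (widen_ord (leqnSn (clen dd)) j) (ordS i))%VS.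

Definition quiver_flag_variety (k : fieldType) (n : nat) (M : cyclic_rep k n)
    (dd : composition (dimvec (rspace M))) : fspace k :=
  subspace (@strictly_stable k n M dd).

(* Main.v *)
From HB Require Import structures.
Require Import Defs.
From mathcomp Require Import all_boot all_order all_algebra all_field.
From mathcomp Require Import boolp classical_sets.
From mathcomp Require Import mpoly.

(* Let R be the sum of the maps of M on the total space of V, and fix a basis
   of homogeneous Jordan strings of R, ordered by the height in the string.
   Suppose that the first j steps of the flag are a fixed R-stable coordinate
   subspace E(T).  The next step, modulo E(T), lies in the kernel of the map
   induced on V / E(T), which is spanned by the ends of the strings.  The
   dimensions of its intersections with the subspaces spanned by upper sets of
   the basis are upper semicontinuous, and fixing them all cuts out a Schubert
   cell.  A subspace of this cell is g(x) E(C) for a unique unipotent g(x) that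
   commutes with R modulo E(T): it moves whole strings to strings at least as
   high, and its entries x are reduced echelon coordinates, so they are regular
   on the cell.  Hence F |-> (x, g(-x) F) trivializes the cell over the flags
   whose step j + 1 is E(C), and descending induction on j concludes. *)

Set Implicit Arguments.
Unset Strict Implicit.
Unset Printing Implicit Defensive.

Import GRing.Theory.
Local Open Scope classical_set_scope.
Local Open Scope ring_scope.

(** * Regular functions *)

(** The order by height is forced. A map of strings that respects R must send the first vector of
    its source string somewhere: a shift towards greater height always leaves room for it, a shift
    downwards would push it off the beginning of the target string. Commutation with R fails only at
    the last vector that is moved, and there the error lies in E(T), because the target is an end
    modulo E(T). This is harmless: the steps before j lie in E(T), where g(x) is the identity, and
    all others contain E(T).

    A string has at most one end outside T, and moves go from pivots to non-pivots. So a string that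
    is moved never receives another one, products of moves vanish, and g(x) has inverse g(-x).

    The flag variety is a quotient of the space of frames: functions on it are tested on frames, and
    maps into it are shown to be morphisms by lifting them to frames. Hence g(x) acts on frames as
    well as on flags, and every cell keeps a lift of its parametrization. *)

Section FspaceTheory.
Variables (k : fieldType) (X : fspace k).

Lemma fopen_local (A : set X) :
  (forall x, A x -> exists W, [/\ fopen W, W x & W `<=` A]) -> fopen A.
Proof.
move=> loc.
rewrite (_ : A = \bigcup_(W in [set W | fopen W /\ W `<=` A]) W).
  by apply: fopen_bigcup => W [].
apply/seteqP; split=> [x /loc[W [oW Wx WA]]|x [W [_ WA] /WA]] //.
by exists W.
Qed.

Lemma fopenU (A B : set X) : fopen A -> fopen B -> fopen (A `|` B).
Proof.
move=> oA oB; apply: fopen_local => x [Ax|Bx].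
  by exists A; split=> // y; left.
by exists B; split=> // y; right.
Qed.

Lemma fopen0 : fopen (set0 : set X).
Proof. by apply: fopen_local. Qed.

Lemma fopen_nbhs_all (I : finType) (Q : I -> set X -> Prop) (x : X) :
    (forall i W W', fopen W -> fopen W' -> W' `<=` W -> Q i W -> Q i W') ->
    (forall i, exists W, [/\ fopen W, W x & Q i W]) ->
  exists W, [/\ fopen W, W x & forall i, Q i W].
Proof.
move=> Qsub Qex.
have: forall s : seq I, exists W, [/\ fopen W, W x & forall i, i \in s -> Q i W].
  elim=> [|i s [W [oW Wx QW]]]; first by exists setT; split=> //; exact: fopenT.
  have [W' [oW' Wx' QW']] := Qex i; have oI := fopenI oW oW'.
  exists (W `&` W'); split=> // j; rewrite inE => /predU1P[->|/QW].
    by apply: Qsub QW' => // y [].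
  by apply: Qsub => // y [].
move=> /(_ (enum I))[W [oW Wx QW]]; exists W; split=> // i.
by apply: QW; rewrite mem_enum.
Qed.

Lemma regularN U (f : X -> k) :
  fopen U -> regular U f -> regular U (fun x => - f x).
Proof.
move=> oU rf.
apply: (@regular_ext _ _ _ (fun x => -1 * f x)) => [x _|]; first by rewrite mulN1r.
by apply: regularM => //; exact: regular_cst.
Qed.

Lemma regular_sum U (I : Type) (s : seq I) (P : pred I) (f : I -> X -> k) :
    fopen U -> (forall i, P i -> regular U (f i)) ->
  regular U (fun x => \sum_(i <- s | P i) f i x).
Proof.
move=> oU rf; elim: s => [|i s IHs].
  apply: (@regular_ext _ _ _ (fun=> 0)) => [x _|]; first by rewrite big_nil.
  exact: regular_cst.
have [Pi|nPi] := boolP (P i); last first.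
  by apply: regular_ext IHs => x _; rewrite big_cons (negPf nPi).
apply: (@regular_ext _ _ _ (fun x => f i x + \sum_(i <- s | P i) f i x)).
  by move=> x _; rewrite big_cons Pi.
by apply: regularD => //; apply: rf.
Qed.

Lemma regular_prod U (I : Type) (s : seq I) (P : pred I) (f : I -> X -> k) :
    fopen U -> (forall i, P i -> regular U (f i)) ->
  regular U (fun x => \prod_(i <- s | P i) f i x).
Proof.
move=> oU rf; elim: s => [|i s IHs].
  apply: (@regular_ext _ _ _ (fun=> 1)) => [x _|]; first by rewrite big_nil.
  exact: regular_cst.
have [Pi|nPi] := boolP (P i); last first.
  by apply: regular_ext IHs => x _; rewrite big_cons (negPf nPi).
apply: (@regular_ext _ _ _ (fun x => f i x * \prod_(i <- s | P i) f i x)).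
  by move=> x _; rewrite big_cons Pi.
by apply: regularM => //; apply: rf.
Qed.

Lemma regular_det U n (A : X -> 'M[k]_n) :
    fopen U -> (forall i j, regular U (fun x => A x i j)) ->
  regular U (fun x => \det (A x)).
Proof.
move=> oU rA; apply: regular_sum => // s _; apply: regularM => //.
  exact: regular_cst.
by apply: regular_prod => // i _.
Qed.

Lemma regular_adj U n (A : X -> 'M[k]_n) i j :
    fopen U -> (forall i j, regular U (fun x => A x i j)) ->
  regular U (fun x => (\adj (A x)) i j).
Proof.
move=> oU rA.
apply: (@regular_ext _ _ _ (fun x => cofactor (A x) j i)) => [x _|].
  by rewrite mxE.
apply: regularM => //; first exact: regular_cst.
apply: regular_det => // i' j'.
by apply: regular_ext (rA (lift j i') (lift i j')) => x _; rewrite !mxE.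
Qed.

Lemma regular_meval U n (s : {mpoly k[n]}) (f : 'I_n -> X -> k) :
    fopen U -> (forall i, regular U (f i)) ->
  regular U (fun x => s.@[fun i => f i x]).
Proof.
move=> oU rf.
apply: (@regular_ext _ _ _
  (fun x => \sum_(m <- msupp s) s@_m * \prod_i f i x ^+ m i)) => [x _|].
  by rewrite mevalE.
apply: regular_sum => // m _; apply: regularM => //; first exact: regular_cst.
apply: regular_prod => // i _.
elim: (m i) => [|d IHd]; first exact: regular_cst.
apply: (@regular_ext _ _ _ (fun x => f i x * f i x ^+ d)) => [x _|].
  by rewrite exprS.
exact: regularM.
Qed.

(* [f] is regular on [A], a not necessarily open set with the induced
   structure. *)
Definition locally_regular (A : set X) (f : X -> k) : Prop :=
  forall x, A x -> exists W g, [/\ fopen W, W x, regular W g &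
    forall y, A y -> W y -> f y = g y].

Variables (Y : Type) (N : nat) (c : Y -> 'I_N -> k).

(** Together with the next lemma: a map into a space with coordinates is a morphism once its
    coordinates are regular, since polynomials in regular functions are regular and their
    nonvanishing loci are open. The domain [U] is kept explicit because most maps below are only
    defined locally. *)
Lemma to_zariski_open U (f : X -> Y) (W : set (zariski c)) :
    fopen U -> (forall a, regular U (fun x => c (f x) a)) ->
  fopen W -> fopen [set x | U x /\ W (f x)].
Proof.
move=> oU rf oW; apply: fopen_local => x [Ux /oW[s [sx sW]]].
have rs := regular_meval s oU rf; have [oV _] := regularV oU rs.
by exists [set y | U y /\ s.@[c (f y)] != 0]; split=> // y [Uy /sW].
Qed.

Lemma to_zariski_regular U (f : X -> Y) (W : set (zariski c)) h :
    fopen U -> (forall a, regular U (fun x => c (f x) a)) ->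
    fopen W -> regular W h ->
  regular [set x | U x /\ W (f x)] (fun x => h (f x)).
Proof.
move=> oU rf oW rh; have oUW := to_zariski_open oU rf oW.
apply: regular_local => // x [Ux Wfx]; have [a [b [bx ab]]] := rh _ Wfx.
have rb := regular_meval b oU rf; have [oV rV] := regularV oU rb.
set V := [set y | _ /\ _] in oV rV; have oI := fopenI oUW oV.
exists ([set x | U x /\ W (f x)] `&` V); split=> //.
apply: (@regular_ext _ _ _ (fun x => a.@[c (f x)] * (b.@[c (f x)])^-1)).
  by move=> y [[Uy Wy] [_ /= by0]]; rewrite -ab.
apply: regularM => //; last by apply: regular_sub rV => // y [].
have ra := regular_meval a oU rf.
by apply: regular_sub ra => // y [[]].
Qed.

End FspaceTheory.

Lemma zariski_coord_regular (k : fieldType) (Y : Type) N (c : Y -> 'I_N -> k) a :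
  @regular k (zariski c) setT (fun y => c y a).
Proof.
move=> x _; exists 'X_a, 1; rewrite meval1 oner_neq0; split=> // y _ _.
by rewrite mevalXU meval1 divr1.
Qed.

(** * Paved subsets *)

Section PavedSubsets.
Variables (k : fieldType) (E : Type) (N : nat) (c : E -> 'I_N -> k).
Variables (Y : Type) (pi : E -> Y).
Let X : fspace k := quotient_space (X := zariski c) pi.

(* Subsets parametrized by an affine space; the parametrization is required to
   lift along [pi]. *)
Definition affine_cell (A : set X) : Prop :=
  exists m (psi : 'rV[k]_m -> E) (phi : X -> 'rV[k]_m),
    [/\ forall a, @regular k (affine_space k m) setT (fun y => c (psi y) a),
        forall y, A (pi (psi y)),
        forall x, A x -> pi (psi (phi x)) = x,
        forall y, phi (pi (psi y)) = y &
        forall a, locally_regular A (fun x => phi x 0 a)].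

(** A tree of splittings into a relatively closed part, outside [W], and a relatively open part,
    inside [W]. Inductions follow this tree, and the numbering of the pieces is postponed to
    [paved_seq]. *)
Inductive paved : set X -> Prop :=
| paved0 : paved set0
| paved_cell A : affine_cell A -> paved A
| paved_split A W : fopen W -> paved (A `\` W) -> paved (A `&` W) -> paved A.

(** The pieces outside [W] are listed before those inside it, so that tails of the list are
    relatively open: a tail starting in the first half is a tail of that half together with [W], and
    one starting in the second half is cut out inside [W]. *)
Lemma paved_seq A : paved A -> exists (r : nat) (P : nat -> set X),
  [/\ forall x, A x -> exists2 i, (i < r)%N & P i x,
      forall i j x, (i < r)%N -> (j < r)%N -> P i x -> P j x -> i = j,
      forall i, (i < r)%N -> affine_cell (P i) /\ P i `<=` A &
      forall l, (l <= r)%N -> exists2 W : set X, fopen W &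
        forall x, A x -> W x <-> exists2 i, (l <= i < r)%N & P i x].
Proof.
elim=> {A} [|A cA|A W oW _ [r1 [P1 [cov1 dis1 cell1 op1]]]
                        _ [r2 [P2 [cov2 dis2 cell2 op2]]]].
- exists 0%N, (fun=> set0); split=> // l _.
  by exists setT => //; exact: fopenT.
- exists 1%N, (fun=> A); split=> [x Ax|i j x|i|l].
  + by exists 0%N.
  + by rewrite !ltnS !leqn0 => /eqP-> /eqP->.
  + by move=> _; split=> // x.
  + case: l => [_|l].
      exists setT; first exact: fopenT.
      by move=> x Ax; split=> // _; exists 0%N.
    move=> _; exists set0; first exact: fopen0.
    move=> x Ax; split=> // -[i /andP[li]].
    by rewrite ltnS leqn0 => /eqP i0; rewrite i0 in li.
pose P i := if (i < r1)%N then P1 i else P2 (i - r1)%N.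
have PW i x : (i < r1 + r2)%N -> P i x -> W x ->
    exists j, [/\ i = r1 + j, j < r2 & P2 j x]%N.
  rewrite /P; case: (ltnP i r1) => [lt _ Pi Wx|le lt Pi _].
    by have [_ /(_ _ Pi)[]] := cell1 _ lt.
  by exists (i - r1)%N; split=> //; rewrite ?subnKC // ltn_subLR.
have PNW i x : (i < r1 + r2)%N -> P i x -> ~ W x -> (i < r1)%N /\ P1 i x.
  rewrite /P; case: (ltnP i r1) => [//|le lt Pi Wx].
  have lt' : (i - r1 < r2)%N by rewrite ltn_subLR.
  by have [_ /(_ _ Pi)[]] := cell2 _ lt'.
exists (r1 + r2)%N, P; split.
- move=> x Ax; have [Wx|Wx] := pselect (W x).
    have [//|i lt Pi] := cov2 x; exists (r1 + i)%N; first by rewrite ltn_add2l.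
    by rewrite /P ltnNge leq_addr addKn.
  have [//|i lt Pi] := cov1 x; exists i; first exact: leq_trans lt (leq_addr _ _).
  by rewrite /P lt.
- move=> i j x lti ltj Pi Pj; have [Wx|Wx] := pselect (W x).
    have [i' [-> lti' Pi']] := PW _ _ lti Pi Wx.
    have [j' [-> ltj' Pj']] := PW _ _ ltj Pj Wx.
    by rewrite (dis2 i' j' x).
  have [lti' Pi'] := PNW _ _ lti Pi Wx; have [ltj' Pj'] := PNW _ _ ltj Pj Wx.
  exact: dis1 Pi' Pj'.
- move=> i; rewrite /P; case: (ltnP i r1) => [lt _|le lt].
    by have [ci sub] := cell1 _ lt; split=> // x /sub[].
  have lt' : (i - r1 < r2)%N by rewrite ltn_subLR.
  by have [ci sub] := cell2 _ lt'; split=> // x /sub[].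
- move=> l lel; have [lel1|ltl1] := leqP l r1.
    have [W1 oW1 W1P] := op1 l lel1; exists (W1 `|` W); first exact: fopenU.
    move=> x Ax; have [Wx|Wx] := pselect (W x).
      split=> [_|]; last by right.
      have [//|i lt Pi] := cov2 x; exists (r1 + i)%N.
        by rewrite (leq_trans lel1 (leq_addr _ _)) ltn_add2l.
      by rewrite /P ltnNge leq_addr addKn.
    split=> [[/(W1P x)[//|i /andP[li lt] Pi]|//]|[i /andP[li lt] Pi]].
      by exists i; [rewrite li (leq_trans lt (leq_addr _ _)) | rewrite /P lt].
    have [lt' Pi'] := PNW _ _ lt Pi Wx; left; apply/W1P => //.
    by exists i => //; rewrite li.
  have [|W2 oW2 W2P] := op2 (l - r1)%N; first by rewrite leq_subLR.
  exists (W `&` W2); first exact: fopenI.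
  move=> x Ax; split=> [[Wx /(W2P x)[//|i /andP[li lt] Pi]]|[i /andP[li lt] Pi]].
    exists (r1 + i)%N; first by rewrite -leq_subLR li ltn_add2l.
    by rewrite /P ltnNge leq_addr addKn.
  have Wx : W x.
    apply: contrapT => Wx; have [lt' _] := PNW _ _ lt Pi Wx.
    by have := leq_trans lt' (leq_trans (ltnW ltl1) li); rewrite ltnn.
  have [j [ij ltj Pj]] := PW _ _ lt Pi Wx; split=> //; apply/W2P => //.
  by exists j => //; rewrite leq_subLR -ij li.
Qed.

Lemma affine_cell_isomorphic (A P : set X) : affine_cell P -> P `<=` A ->
  exists m, isomorphic
    (subspace ([set x | P (\val x)] : set (subspace A))) (affine_space k m).
Proof.
move=> [m [psi [phi [rpsi psiP psiK phiK rphi]]]] PA; exists m.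
set Q : set (subspace A) := [set x | P (\val x)].
have QP y : Q (SigSub (mem_set (PA _ (psiP y)))) by exact: psiP.
pose g (y : affine_space k m) : subspace Q := SigSub (mem_set (QP y)).
pose f (x : subspace Q) : affine_space k m := phi (\val (\val x)).
have memQ (x : subspace Q) : P (\val (\val x)).
  by have := valP x; rewrite in_setE.
exists f, g; split.
- have rf a : @regular k (subspace Q) setT (fun x => f x 0 a).
    move=> x _; have [W [h [oW Wx rh hP]]] := rphi a _ (memQ x).
    exists [set z | W (\val z)], (fun z => h (\val z)); split=> //.
    + by exists W.
    + move=> z Wz; exists W, h; split=> //.
    + by move=> y _ Wy; rewrite /f hP //; exact: memQ.
  have sE (U : set (affine_space k m)) :
      [set x | setT x /\ U (f x)] = f @^-1` U.
    by apply/seteqP; split=> x // [].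
  move=> U oU; split=> [|h rh].
    by rewrite -sE; apply: to_zariski_open => //; exact: fopenT.
  by rewrite -sE; apply: to_zariski_regular => //; exact: fopenT.
- have rg (W : set X) : fopen W ->
      fopen [set y : affine_space k m | W (pi (psi y))] /\
      forall h, regular W h ->
        @regular k (affine_space k m) [set y | W (pi (psi y))] (fun y => h (pi (psi y))).
    move=> oW; have sE : [set y : affine_space k m | setT y /\ W (pi (psi y))] =
        [set y | W (pi (psi y))] by apply/seteqP; split=> x // [].
    split=> [|h rh]; rewrite -sE.
      apply: (@to_zariski_open k (affine_space k m) E N c setT psi (pi @^-1` W)) => //.
      exact: fopenT.
    apply: (@to_zariski_regular k (affine_space k m) E N c setT psi
      (pi @^-1` W) (h \o pi)) => //.
    exact: fopenT.
  move=> U oU; have oU' : @fopen _ (affine_space k m) (g @^-1` U).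
    case: oU => W1 [W2 oW2 ->] ->; exact: (rg W2 oW2).1.
  split=> // h rh; apply: regular_local => // y Uy.
  (* The cell is a subspace of a subspace: [h] extends locally to [h1] on [A], and [h1] extends
     locally to [h2] on [X]. *)
  have [W1 [h1 [oW1 Wy rh1 h1P]]] := rh _ Uy.
  have [W2 [h2 [oW2 Wy2 rh2 h2P]]] := rh1 _ Wy.
  have [W3 oW3 W1E] := oW1.
  have oW23 : fopen (W2 `&` W3) by exact: fopenI.
  have [oV rV] := rg _ oW23.
  exists (g @^-1` U `&` [set y | (W2 `&` W3) (pi (psi y))]); split.
  + exact: fopenI.
  + by split=> //; split=> //; move: Wy; rewrite W1E.
  + by move=> z [].
  + have rh2' : regular (W2 `&` W3) h2 by apply: regular_sub rh2 => // z [].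
    apply: (@regular_ext k (affine_space k m) _ (fun y => h2 (pi (psi y)))).
      move=> z [Uz [W2z W3z]] /=.
      have W1z : W1 (\val (g z)) by rewrite W1E.
      by rewrite h1P // h2P.
    apply: regular_sub (rV h2 rh2') => //.
    exact: fopenI.
- by move=> x; apply: val_inj; apply: val_inj; rewrite /= psiK //; exact: memQ.
- by move=> y; rewrite /f /= phiK.
Qed.

Lemma paved_affine_paving A : paved A -> affine_paving (subspace A).
Proof.
move=> /paved_seq[r [P [cov dis cell op]]].
have memA (x : subspace A) : A (\val x) by have := valP x; rewrite in_setE.
pose Q (i : 'I_r) : set (subspace A) := [set x | P i (\val x)].
have sufP l : (l <= r)%N ->
    exists2 W : set (subspace A), fopen W &
      forall x, W x <-> exists2 i : 'I_r, (l <= i)%N & Q i x.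
  move=> ler; have [W oW WP] := op l ler.
  exists [set x | W (\val x)]; first by exists W.
  move=> x; split=> [/WP[//|i /andP[li lt] Pi]|[i li Qi]].
    by exists (Ordinal lt).
  by apply/WP => //; exists i; rewrite // li /=.
have QU i j x : Q i x -> Q j x -> i = j.
  by move=> Qi Qj; apply/val_inj/(dis i j (\val x)) => //.
have prefix_closed (l : nat) : (l <= r)%N ->
    Defs.fclosed (\bigcup_(i in [set i : 'I_r | (i < l)%N]) Q i).
  move=> ler; have [W oW WP] := sufP l ler; rewrite /Defs.fclosed.
  rewrite (_ : ~` _ = W) //; apply/seteqP; split=> x.
    move=> nx; apply/WP; have [|i lt Pi] := cov (\val x); first exact: memA.
    exists (Ordinal lt) => //=; rewrite leqNgt; apply/negP => il; apply: nx.
    by exists (Ordinal lt).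
  move=> /WP[i li Qi] [j /= lj Qj].
  by move: lj; rewrite -(QU _ _ _ Qi Qj) ltnNge li.
exists r, Q; split.
- move=> x; have [|i lt Pi] := cov (\val x); first exact: memA.
  by exists (Ordinal lt); split=> // j Qj; apply: QU Qj.
- move=> i; have [W oW WP] := sufP i (ltnW (ltn_ord i)).
  (* A piece is the intersection of the open tail that begins with it and the closed initial part
     that ends with it. *)
  exists W, (\bigcup_(i' in [set i' : 'I_r | (i' < i.+1)%N]) Q i'); split=> //.
    exact: (@prefix_closed i.+1 (ltn_ord i)).
  apply/seteqP; split=> x.
    by move=> Qi; split; [apply/WP; exists i | exists i => //=].
  move=> [/WP[j ij Qj] [j' /= j'i Qj']].
  rewrite (_ : i = j) //; apply/val_inj/eqP.
  by rewrite eqn_leq ij (QU _ _ _ Qj Qj') -ltnS.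
- by move=> l; exact: (@prefix_closed l.+1 (ltn_ord l)).
- by move=> i; have [ci sub] := cell i (ltn_ord i); exact: affine_cell_isomorphic.
Qed.

End PavedSubsets.

(** * Transport of pavings along a trivialization *)

Section Trivialization.
Variables (k : fieldType) (E : Type) (N : nat) (c : E -> 'I_N -> k).
Variables (Y : Type) (pi : E -> Y).
Let X : fspace k := quotient_space (X := zariski c) pi.

Variables (m : nat) (gE : 'rV[k]_m -> E -> E) (gX : 'rV[k]_m -> X -> X).
Hypothesis gE_pi : forall y e, pi (gE y e) = gX y (pi e).
(** Families over an arbitrary base [T] express that [gE] is a morphism in both variables jointly,
    without forming a product space. *)
Hypothesis gE_regular : forall (T : fspace k) (U : set T)
    (y : T -> 'rV[k]_m) (e : T -> E), fopen U ->
  (forall a, regular U (fun t => y t 0 a)) ->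
  (forall a, regular U (fun t => c (e t) a)) ->
  forall a, regular U (fun t => c (gE (y t) (e t)) a).
Hypothesis gXK : forall y x, gX (- y) (gX y x) = x.

Variables (A B : set X) (h : X -> 'rV[k]_m).
Hypothesis h_regular : forall a, locally_regular A (fun x => h x 0 a).
Hypothesis gAB : forall x, A x -> B (gX (- h x) x).
Hypothesis gBA : forall y x, B x -> A (gX y x) /\ h (gX y x) = y.

Let t x := gX (- h x) x.

(** The set [A] need not be open and [h] is regular only on it. Near [x] it agrees with a family [H]
    of regular functions on an open [U], and [gX (- H y) y] is a morphism on [U] since it lifts to
    [E]; it restricts to [t] on [A]. *)
Lemma trivialization_local x W f : A x -> fopen W -> W (t x) -> regular W f ->
  exists W' f', [/\ fopen W', W' x, regular W' f' &
    forall y, A y -> W' y -> W (t y) /\ f (t y) = f' y].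
Proof.
move=> Ax oW Wx rf.
have [U [oU Ux UP]] : exists U : set X, [/\ fopen U, U x & forall a : 'I_m,
    exists2 g, regular U g & forall y, A y -> U y -> h y 0 a = g y].
  apply: (@fopen_nbhs_all k X 'I_m (fun a U => exists2 g, regular U g &
    forall y, A y -> U y -> h y 0 a = g y)) => [a U U' oU oU' UU' [g rg gP]|a].
    exists g; first exact: regular_sub rg.
    by move=> y Ay /UU'; apply: gP.
  have [U [g [oU Ux rg gP]]] := h_regular a Ax.
  by exists U; split=> //; exists g.
have {UP} [H [rH HP]] : exists H : X -> 'rV[k]_m,
    (forall a, regular U (fun y => - H y 0 a)) /\
    forall y, A y -> U y -> h y = H y.
  have {}UP (a : 'I_m) : exists g : X -> k, regular U g /\
    forall y, A y -> U y -> h y 0 a = g y by have [g] := UP a; exists g.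
  have [H HP] := choice UP.
  exists (fun y => \row_a H a y); split=> [a|y Ay Uy].
    apply: (@regular_ext k X _ (fun y => - H a y)) => [y _|].
      by rewrite mxE.
    by apply: regularN => //; have [] := HP a.
  by apply/rowP => a; rewrite mxE; have [_ ->] := HP a.
pose tE e := gE (- H (pi e)) e; pose U' := pi @^-1` U.
have rtE a : @regular k (zariski c) U' (fun e => c (tE e) a).
  apply: gE_regular => // {}a.
    apply: (@regular_ext k (zariski c) _ ((fun y => - H y 0 a) \o pi)).
      by move=> y _; rewrite mxE.
    exact: rH.
  by apply: regular_sub (zariski_coord_regular (c := c) a) => //; exact: fopenT.
have oW' := @to_zariski_open k (zariski c) E N c U' tE (pi @^-1` W) oU rtE oW.
have rW' := @to_zariski_regular k (zariski c) E N c U' tE (pi @^-1` W)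
  (f \o pi) oU rtE oW rf.
have tEP e : pi (tE e) = gX (- H (pi e)) (pi e) by rewrite gE_pi.
exists [set y | U y /\ W (gX (- H y) y)], (fun y => f (gX (- H y) y)).
have setE : pi @^-1` [set y | U y /\ W (gX (- H y) y)] =
    [set e | U' e /\ (pi @^-1` W) (tE e)].
  by apply/seteqP; split=> e; rewrite /preimage /= tEP.
split.
- by rewrite /fopen /= /qopen setE.
- by split=> //; rewrite -HP.
- rewrite /regular /= /qregular setE.
  apply: (@regular_ext k (zariski c) _ (fun e => (f \o pi) (tE e))) rW'.
  by move=> e _ /=; rewrite tEP.
- by move=> y Ay [Uy Wy]; rewrite /t HP.
Qed.

(** [A] is the product of an affine space and [B] through [x |-> (h x, t x)]. A cell of [B] with
    parameters in dimension [r] pulls back to one in dimension [m + r], and open splittings pull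
    back along [t]. *)
Lemma paved_trivialization : @paved _ _ _ c _ pi B -> @paved _ _ _ c _ pi A.
Proof.
have AE : A = [set x | A x /\ B (t x)].
  by apply/seteqP; split=> x; [move=> Ax; split=> //; exact: gAB | case].
suff main P : @paved _ _ _ c _ pi P -> P `<=` B ->
    @paved _ _ _ c _ pi [set x | A x /\ P (t x)].
  by rewrite AE => pB; apply: main.
elim=> {P} [_|P [r [psi [phi [rpsi psiP psiK phiK rphi]]]] PB
          |P W oW _ IH1 _ IH2 PB].
- rewrite (_ : [set x | _] = set0); first exact: paved0.
  by apply/seteqP; split=> x // [].
- apply: paved_cell.
  pose psi' (y : 'rV[k]_(m + r)) := gE (lsubmx y) (psi (rsubmx y)).
  exists (m + r)%N, psi', (fun x => row_mx (h x) (phi (t x))).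
  have tB y x : B x -> t (gX y x) = x.
    by move=> Bx; rewrite /t (gBA y Bx).2 gXK.
  have BP y : B (pi (psi y)).
    by apply: PB; exact: psiP.
  split.
  + have coordr (n1 n2 : nat) (f : 'I_n1 -> 'I_n2) a :
        @regular k (affine_space k n2) setT (fun y => y 0 (f a)).
      exact: (zariski_coord_regular (c := fun (y : 'rV[k]_n2) b => y 0 b)).
    apply: (gE_regular (T := affine_space k (m + r))) => [|a|a].
    * exact: fopenT.
    * apply: (@regular_ext k (affine_space k (m + r)) _ (fun y => y 0 (lshift r a))).
        by move=> y _; rewrite mxE.
      exact: coordr.
    * have sE : [set y : 'rV[k]_(m + r) | setT y /\ setT (rsubmx y)] = setT.
        by apply/seteqP; split.
      rewrite -[X in @regular _ _ X]sE.
      apply: (@to_zariski_regular k (affine_space k (m + r)) _ r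
        (fun (y : 'rV[k]_r) b => y 0 b) setT (fun y => rsubmx y) setT
        (fun y => c (psi y) a)) => //; try exact: fopenT.
      move=> b; apply: (@regular_ext k (affine_space k (m + r)) _ (fun y => y 0 (rshift m b))).
        by move=> y _; rewrite mxE.
      exact: coordr.
  + move=> y; rewrite /psi' gE_pi; split; first exact: (gBA _ (BP _)).1.
    by rewrite /= tB //; exact: psiP.
  + move=> x [Ax Pt]; rewrite /psi' row_mxKl row_mxKr gE_pi psiK //.
    by rewrite /t -{1}[h x]opprK gXK.
  + by move=> y; rewrite /psi' gE_pi tB // phiK (gBA _ (BP _)).2 hsubmxK.
  + move=> a x [Ax Ptx]; case: (splitP a) => b ab.
      have -> : a = lshift r b by apply: val_inj.
      have [W [g [oW Wx rg gP]]] := h_regular b Ax.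
      by exists W, g; split=> // y [Ay _] Wy; rewrite row_mxEl gP.
    have -> : a = rshift m b by apply: val_inj.
    have [W [g [oW Wtx rg gP]]] := rphi b _ Ptx.
    have [W' [g' [oW' W'x rg' g'P]]] := trivialization_local Ax oW Wtx rg.
    exists W', g'; split=> // y [Ay Pty] W'y; have [Wty gg'] := g'P y Ay W'y.
    by rewrite row_mxEr gP.
- have [W' oW' W'P] : exists2 W', @fopen k X W' & forall x, A x -> W' x <-> W (t x).
    pose D := [set V | @fopen k X V /\ forall x, A x -> V x -> W (t x)].
    exists (\bigcup_(V in D) V); first by apply: fopen_bigcup => V [].
    move=> x Ax; split=> [[V [oV VP] Vx]|Wx]; first exact: VP.
    (* Only the neighbourhood is wanted here, so the function fed to [trivialization_local] is
       zero. *)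
    have r0 : @regular k X W (fun=> 0) by exact: regular_cst.
    have [V [f' [oV Vx _ VP]]] := trivialization_local Ax oW Wx r0.
    by exists V => //; split=> // y Ay /(VP y Ay)[].
  apply: (paved_split oW').
    rewrite (_ : _ `\` _ = [set x | A x /\ (P `\` W) (t x)]).
      by apply: IH1 => x [/PB].
    apply/seteqP; split=> x.
      by move=> [[Ax Px] nW'x]; split=> //; split=> // /(W'P x Ax).
    by move=> [Ax [Px nWx]]; split=> // /(W'P x Ax).
  rewrite (_ : _ `&` _ = [set x | A x /\ (P `&` W) (t x)]).
    by apply: IH2 => x [/PB].
  apply/seteqP; split=> x.
    by move=> [[Ax Px] W'x]; split=> //; split=> //; apply/(W'P x Ax).
  by move=> [Ax [Px Wx]]; split=> //; apply/(W'P x Ax).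
Qed.

End Trivialization.

(** * Flags of graded subspaces *)

Lemma mem_span_take (k : fieldType) (V : vectType k) (D p : nat)
    (X : D.-tuple V) v :
  v \in <<take p X>>%VS -> exists c : 'I_D -> k,
    v = \sum_(l < D | (l < p)%N) c l *: tnth X l.
Proof.
move=> vX; have: v \in (\sum_(l < D | (l < p)%N) <[tnth X l]>)%VS.
  apply: subvP v vX; apply/span_subvP => u /(nthP 0)[l].
  rewrite size_take_min size_tuple ltn_min => /andP[lp lD] <-.
  rewrite nth_take //; apply: subvP (memv_line _).
  by apply: (sumv_sup (Ordinal lD)) => //; rewrite (tnth_nth 0).
move=> /memv_sumP[u uX ->].
have cP (l : 'I_D) : exists c : k, (l < p)%N -> u l = c *: tnth X l.
  have [lp|] := boolP (l < p)%N; last by exists 0.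
  by have /vlineP[c uE] := uX l lp; exists c.
have [c cE] := choice cP; exists c.
by apply: eq_bigr => l; apply: cE.
Qed.

Section FlagGeometry.
Variables (k : fieldType) (n : nat) (V : 'I_n -> vectType k).
Variable (dd : composition (dimvec V)).

Let E := frame V.
Let c := @frame_coord k n V.
Let X := flag_variety dd.

Lemma frame_vector_regular (T : fspace k) (U : set T) (e : T -> E) i
    (l : 'I_(\dim {: V i})) (chi : {scalar V i}) : fopen U ->
    (forall a, regular U (fun t => c (e t) a)) ->
  regular U (fun t => chi (tnth (\val (e t) i) l)).
Proof.
move=> oU re; pose J : {i : 'I_n & ('I_(\dim {: V i}) * 'I_(\dim {: V i}))%type} -> _
  := fun x => enum_rank x.
apply: (@regular_ext k T _ (fun t => \sum_(j < \dim {: V i})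
    c (e t) (J (existT _ i (l, j))) * chi (vbasis fullv)`_j)).
  move=> t _; rewrite [tnth _ _ in RHS](coord_vbasis (memvf _)) linear_sum.
  by apply: eq_bigr => j _; rewrite linearZ /c /frame_coord /J enum_rankK.
apply: regular_sum => // j _; apply: regularM => //; exact: regular_cst.
Qed.

(** * Unipotent automorphisms acting on frames and flags *)

Section Action.
Variables (m : nat) (N : 'I_m -> forall i, 'End(V i)).
Hypothesis NN : forall a b i, (N a i \o N b i)%VF = 0.

(** As all products of the [N a] vanish, this is the exponential of the sum of the [y 0 a *: N a];
    its inverse is obtained from [- y]. *)
Definition unip (y : 'rV[k]_m) i : 'End(V i) :=
  (\1 + \sum_a y 0 a *: N a i)%VF.

Lemma unipE y i v : unip y i v = v + \sum_a y 0 a *: N a i v.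
Proof.
rewrite add_lfunE id_lfunE sum_lfunE; congr (_ + _).
by apply: eq_bigr => a _; rewrite scale_lfunE.
Qed.

Lemma unipNK y i v : unip (- y) i (unip y i v) = v.
Proof.
have NN0 a b : N a i (N b i v) = 0.
  by rewrite -comp_lfunE NN zero_lfunE.
rewrite !unipE -addrA -big_split /= big1 ?addr0 // => a _.
rewrite mxE linearD linear_sum /= [\sum_(_ < _) _]big1 => [|b _].
  by rewrite addr0 scaleNr addrN.
by rewrite linearZ /= NN0 scaler0.
Qed.

Lemma unip_lker0 y i : lker (unip y i) == 0%VS.
Proof. by apply/lker0P; apply: (can_inj (g := unip (- y) i)) => v; exact: unipNK. Qed.

Lemma dim_unip y i (U : {vspace V i}) : \dim (unip y i @: U) = \dim U.
Proof.
by rewrite limg_dim_eq // (eqP (unip_lker0 y i)) capv0.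
Qed.

Lemma unip_img_full y i : (unip y i @: fullv)%VS = fullv.
Proof. by apply/eqP; rewrite eqEdim subvf dim_unip leqnn. Qed.

Lemma unip_frame_subproof y (e : E) :
  [forall i, basis_of fullv [tuple of map (unip y i) (\val e i)]].
Proof.
apply/forallP => i; have /forallP/(_ i) ei := valP e.
rewrite -[X in basis_of X](unip_img_full y i) limg_basis_of //.
by rewrite (eqP (unip_lker0 y i)) capv0.
Qed.

Definition unip_frame y (e : E) : E :=
  exist _ (fun i => [tuple of map (unip y i) (\val e i)]) (unip_frame_subproof y e).

Lemma unip_flag_subproof y (F : X) :
  is_flag (dd := dd) (fun j i => unip y i @: \val F j i)%VS.
Proof.
have [F0 FT Fsub Fdim] : is_flag (dd := dd) (\val F) by have := valP F; rewrite in_setE.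
split=> [i|i|j i|j i]; first by rewrite F0 limg0.
- by rewrite FT unip_img_full.
- exact: limgS.
- by rewrite !dim_unip.
Qed.

Definition unip_flag y (F : X) : X := SigSub (mem_set (unip_flag_subproof y F)).

Lemma frame_flag_unip y e :
  frame_flag dd (unip_frame y e) = unip_flag y (frame_flag dd e).
Proof.
apply: val_inj; apply/funext => j; apply: functional_extensionality_dep => i /=.
by rewrite /frame_flag_fun /= limg_span map_take.
Qed.

Lemma unip_flagNK y F : unip_flag (- y) (unip_flag y F) = F.
Proof.
apply: val_inj; apply/funext => j; apply: functional_extensionality_dep => i /=.
rewrite -limg_comp (_ : (_ \o _)%VF = \1%VF) ?lim1g //.
by apply/lfunP => v; rewrite comp_lfunE unipNK id_lfunE.
Qed.

Lemma unip_frame_regular (T : fspace k) (U : set T) (y : T -> 'rV[k]_m)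
    (e : T -> E) : fopen U ->
    (forall a, regular U (fun t => y t 0 a)) ->
    (forall a, regular U (fun t => c (e t) a)) ->
  forall a, regular U (fun t => c (unip_frame (y t) (e t)) a).
Proof.
move=> oU ry re a; rewrite /c /frame_coord; case: (enum_val a) => i [b l].
apply: (@regular_ext k T _ (fun t =>
    coord (vbasis fullv) l (tnth (\val (e t) i) b) + \sum_a' y t 0 a' *
    (coord (vbasis fullv) l \o N a' i) (tnth (\val (e t) i) b))).
  move=> t _; rewrite tnth_map unipE linearD linear_sum; congr (_ + _).
  by apply: eq_bigr => a' _; rewrite linearZ.
apply: regularD => //; first exact: frame_vector_regular.
apply: regular_sum => // a' _; apply: regularM => //.
exact: frame_vector_regular.
Qed.

Lemma paved_unip (A B : set X) (h : X -> 'rV[k]_m) :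
    (forall a, locally_regular A (fun F => h F 0 a)) ->
    (forall F, A F -> B (unip_flag (- h F) F)) ->
    (forall y F, B F -> A (unip_flag y F) /\ h (unip_flag y F) = y) ->
  @paved k E _ c _ (frame_flag dd) B -> @paved k E _ c _ (frame_flag dd) A.
Proof.
apply: paved_trivialization.
- exact: frame_flag_unip.
- exact: unip_frame_regular.
- exact: unip_flagNK.
Qed.

End Action.

(** * Semicontinuity and rational charts on flags *)

Lemma frame_flagE (e : E) (j : 'I_(clen dd).+1) i :
  \val (frame_flag dd e) j i = <<take (partial_dim dd j i) (\val e i)>>%VS.
Proof. by []. Qed.

Lemma frame_flag_mem (e : E) (j : 'I_(clen dd).+1) i (l : 'I_(\dim {: V i})) :
  (l < partial_dim dd j i)%N ->
  tnth (\val e i) l \in \val (frame_flag dd e) j i.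
Proof.
move=> lp; rewrite frame_flagE memv_span // (tnth_nth 0).
by rewrite -(nth_take _ lp) mem_nth // size_take_min size_tuple leq_min lp ltn_ord.
Qed.

Lemma dim_flag (F : X) (j : 'I_(clen dd).+1) i : \dim (\val F j i) = partial_dim dd j i.
Proof.
have [F0 _ _ Fdim] : is_flag (dd := dd) (\val F) by have := valP F; rewrite in_setE.
case: j => j; elim: j => [|j IHj] lt.
  rewrite (_ : Ordinal lt = ord0) ?F0 ?dimv0; last exact: val_inj.
  by rewrite /partial_dim big_pred0.
have lt' : (j < clen dd)%N by [].
have /= := Fdim (Ordinal lt') i.
rewrite (_ : lift _ _ = Ordinal lt); last exact: val_inj.
rewrite (_ : widen_ord _ _ = Ordinal (ltnW lt)); last exact: val_inj.
rewrite IHj => -> /=.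
rewrite /partial_dim [RHS](bigD1 (Ordinal lt')) //= addnC; congr (_ + _)%N.
by apply: eq_bigl => l; rewrite ltnS -val_eqE /= ltn_neqAle andbC.
Qed.

(** With [Q] a projection of kernel [W], the dimension of the intersection and the rank of [Q] on
    the step have a constant sum, so the rank must not drop near [e0]. A basis [b] of the image at
    [e0] consists of fixed combinations of the vectors [Q] of the frame; the same combinations at a
    nearby frame stay independent as long as the determinant of their [b]-coordinates, which is 1 at
    [e0], does not vanish. *)
Lemma flag_dim_cap_open (j : 'I_(clen dd).+1) i (W : {vspace V i}) r :
  fopen [set F : X | (\dim (\val F j i :&: W) <= r)%N].
Proof.
rewrite /fopen /= /qopen.
apply: (@fopen_local k (frame_space V)) => e0 /= re0.
pose Q : 'End(V i) := (\1 - projv W)%VF.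
have kerQ : lker Q = W.
  apply/vspaceP => v; rewrite memv_ker add_lfunE opp_lfunE id_lfunE subr_eq0.
  by apply/eqP/idP => [vE|/projv_id ->//]; rewrite vE memv_proj.
have dimQ e : (\dim (\val (frame_flag dd e) j i :&: W) +
    \dim (Q @: \val (frame_flag dd e) j i) = partial_dim dd j i)%N.
  by rewrite -[in X in (X + _)%N]kerQ limg_ker_dim dim_flag.
set QF := (Q @: \val (frame_flag dd e0) j i)%VS in dimQ *.
pose b := vbasis QF; pose p := partial_dim dd j i.
have bP (a : 'I_(\dim QF)) : exists L : 'I_(\dim {: V i}) -> k,
    b`_a = \sum_(l < \dim {: V i} | (l < p)%N) L l *: Q (tnth (\val e0 i) l).
  have : b`_a \in QF by rewrite vbasis_mem // mem_nth // size_tuple.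
  move=> /memv_imgP[v /mem_span_take[L vE] ->]; exists L.
  by rewrite vE linear_sum; apply: eq_bigr => l _; rewrite linearZ.
have [L LP] := choice bP.
pose w (e : E) a := \sum_(l < \dim {: V i} | (l < p)%N) L a l *: Q (tnth (\val e i) l).
pose D (e : E) := \matrix_(a, a') coord b a' (w e a).
have rD : @regular k (frame_space V) setT (fun e => \det (D e)).
  apply: regular_det => [|a a']; first exact: fopenT.
  apply: (@regular_ext k (frame_space V) _ (fun e =>
    \sum_(l < \dim {: V i} | (l < p)%N) L a l * (coord b a' \o Q) (tnth (\val e i) l))).
    move=> e _; rewrite mxE linear_sum; apply: eq_bigr => l _.
    by rewrite linearZ.
  apply: regular_sum => [|l _]; first exact: fopenT.
  apply: regularM; first exact: fopenT.
    by apply: regular_cst; exact: fopenT.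
  apply: (@frame_vector_regular (frame_space V) setT id); first exact: fopenT.
  by move=> a''; exact: (zariski_coord_regular (c := c)).
have [oU _] := regularV (@fopenT _ (frame_space V)) rD.
exists [set e | setT e /\ \det (D e) != 0]; split=> //.
  split=> //; rewrite (_ : D e0 = 1%:M) ?det1 ?oner_neq0 //.
  have wE a : w e0 a = b`_a by exact: esym (LP a).
  apply/matrixP => a a'; rewrite !mxE wE coord_free; last first.
    exact: basis_free (vbasisP _).
  by [].
move=> e [_ De] /=.
have: (\dim QF <= \dim (Q @: \val (frame_flag dd e) j i))%N.
  pose wt := [tuple w e a | a < \dim QF].
  have fr : free wt.
    apply/freeP => x x0 a.
    have: (\row_a x a) *m D e = 0.
      apply/rowP => a'; rewrite !mxE -[RHS](linear0 (coord b a')) -x0.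
      rewrite linear_sum; apply: eq_bigr => a'' _.
      by rewrite linearZ !mxE -tnth_nth tnth_mktuple.
    move=> /(congr1 (mulmx^~ (invmx (D e)))).
    rewrite mulmxK ?unitmxE ?unitfE // mul0mx => /rowP/(_ a).
    by rewrite !mxE.
  rewrite -[X in (X <= _)%N](size_tuple wt) -(eqnP fr) dimvS //.
  apply/span_subvP => u /mapP[a _ ->]; apply: memv_suml => l lp.
  by rewrite memvZ // memv_img // frame_flag_mem.
move=> le; have := dimQ e; rewrite -(dimQ e0) => eq1.
rewrite -(leq_add2r (\dim (Q @: \val (frame_flag dd e) j i))) eq1.
exact: leq_add.
Qed.

(** Cramer's rule. The flags whose step [j] meets the common kernel of the [theta a] trivially form
    an open set containing [A]. There the matrix [D] of the [theta a] on the frame vectors spanning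
    the step, square since [p] is the dimension of the step, is invertible; so the vector dual to
    [b], and with it [xi v], is a rational function of the frame. *)
Lemma chart_regular (j : 'I_(clen dd).+1) i p (theta : 'I_p -> 'Hom(V i, k^o))
    (xi : 'Hom(V i, k^o)) (b : 'I_p) (A : set X) (f : X -> k) :
    p = partial_dim dd j i ->
    (forall F, A F -> exists2 v, v \in \val F j i &
       (forall a, theta a v = (a == b)%:R) /\ f F = xi v) ->
    (forall F v, A F -> v \in \val F j i -> (forall a, theta a v = 0) -> v = 0) ->
  locally_regular A f.
Proof.
move=> pE fP uniqF F0 AF0.
pose K := (\bigcap_a lker (theta a))%VS.
have KP v : reflect (forall a, theta a v = 0) (v \in K).
  apply: (iffP idP) => [vK a|v0].
    by apply/eqP; rewrite -memv_ker; apply: subvP v vK; apply: bigcapv_inf.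
  rewrite memvE; apply/subv_bigcapP => a _.
  by rewrite -memvE memv_ker v0.
pose W : set X := [set F | (\dim (\val F j i :&: K) <= 0)%N].
have oW : fopen W by exact: flag_dim_cap_open.
have WP F : W F <-> forall v, v \in \val F j i -> (forall a, theta a v = 0) -> v = 0.
  rewrite /W /= leqn0 dimv_eq0; split=> [/eqP cap0 v vF /KP vK|WF].
    by apply/eqP; rewrite -memv0 -cap0 memv_cap vF.
  rewrite -subv0; apply/subvP => v; rewrite memv_cap memv0 => /andP[vF /KP vK].
  by rewrite (WF v).
have AW F : A F -> W F by move=> AF; apply/WP => v; exact: uniqF.
have pD : (p <= \dim {: V i})%N by rewrite pE -(dim_flag F0) dimvS ?subvf.
pose u (e : E) (l : 'I_p) := tnth (\val e i) (widen_ord pD l).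
have uF e l : u e l \in \val (frame_flag dd e) j i.
  by apply: frame_flag_mem; rewrite /= -pE.
have spanF e v : v \in \val (frame_flag dd e) j i ->
    exists y : 'rV[k]_p, v = \sum_l y 0 l *: u e l.
  move=> /mem_span_take[y ->]; exists (\row_l y (widen_ord pD l)).
  rewrite -pE; under [RHS]eq_bigr do rewrite mxE /u.
  rewrite (big_ord_narrow (F := fun l => y l *: tnth (\val e i) l) pD).
  by [].
pose D (e : E) := \matrix_(l, a) (theta a (u e l) : k).
have DP e (y : 'rV[k]_p) a :
    theta a (\sum_l y 0 l *: u e l) = (y *m D e) 0 a.
  rewrite mxE linear_sum; apply: eq_bigr => l _.
  by rewrite linearZ mxE.
have unitD e : W (frame_flag dd e) -> D e \in unitmx.
  move=> /WP We; rewrite -row_free_unit -kermx_eq0; apply/eqP/row_matrixP => r.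
  rewrite row0; set y := row r _.
  have yD : y *m D e = 0 by rewrite -row_mul mulmx_ker row0.
  have y0 : \sum_l y 0 l *: u e l = 0.
    apply: We => [|a]; last by rewrite DP yD mxE.
    by apply: memv_suml => l _; rewrite memvZ // uF.
  have /forallP/(_ i)/basis_free fr := valP e.
  apply/rowP => l; rewrite [RHS]mxE.
  (* The coefficients are extended by zero to the whole frame, whose freeness is what is known. *)
  pose z (l : 'I_(\dim {: V i})) := if insub (val l) is Some l' then y 0 l' else 0.
  have zE l' : z (widen_ord pD l') = y 0 l' by rewrite /z valK.
  have fr' := elimT (@freeP _ _ _ (\val e i)) fr; rewrite -zE; apply: fr'.
  rewrite -[RHS]y0 [LHS](bigID (fun l : 'I_(\dim {: V i}) => (l < p)%N)) /=.
  rewrite [X in _ + X]big1 ?addr0.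
    rewrite (big_ord_narrow (F := fun l : 'I_(\dim {: V i}) => z l *: (\val e i)`_l) pD).
    by apply: eq_bigr => l' _; rewrite zE /u (tnth_nth 0).
  by move=> l'' lp; rewrite /z insubN // scale0r.
pose y e : 'rV[k]_p := delta_mx 0 b *m invmx (D e).
have existsP F : exists x : k, W F -> exists2 v, v \in \val F j i &
    (forall a, theta a v = (a == b)%:R) /\ x = xi v.
  have [e <-] := frame_flag_surj F; pose v := \sum_l y e 0 l *: u e l.
  exists (xi v) => We; exists v.
    by apply: memv_suml => l _; rewrite memvZ // uF.
  split=> // a; rewrite DP /y mulmxKV ?unitD // mxE eqxx andTb.
  by rewrite eq_sym.
have [g gP] := choice existsP.
exists W, g; split=> //; first exact: AW.
  rewrite /regular /= /qregular.
  have oW' : @fopen k (frame_space V) (frame_flag dd @^-1` W) by exact: oW.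
  have ru l (chi : 'Hom(V i, k^o)) :
      @regular k (frame_space V) (frame_flag dd @^-1` W) (fun e => chi (u e l)).
    have lin : GRing.linear_for *%R (chi : V i -> k) by move=> a v w; rewrite linearP.
    pose chi' : {scalar V i} := HB.pack (chi : V i -> k)
      (GRing.isLinear.Build k (V i) k *%R (chi : V i -> k) lin).
    apply: (@frame_vector_regular (frame_space V) _ id i _ chi') => // a.
    apply: regular_sub (zariski_coord_regular (c := c) a) => //.
    exact: fopenT.
  have rD l a :
      @regular k (frame_space V) (frame_flag dd @^-1` W) (fun e => D e l a).
    by apply: (@regular_ext k (frame_space V) _ _ _ _ (ru l (theta a))) => e _; rewrite mxE.
  have rdet := regular_det oW' rD; have [oV rV] := regularV oW' rdet.
  have rV' : @regular k (frame_space V) (frame_flag dd @^-1` W)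
      (fun e => (\det (D e))^-1).
    apply: regular_sub rV => // e We; split=> //.
    by have := unitD e We; rewrite unitmxE unitfE.
  (* The value of [g] was chosen flag by flag, yet every frame of the flag computes it: the
     coordinates of the vector in that frame solve the same invertible system. *)
  apply: (@regular_ext k (frame_space V) _ (fun e => \sum_l
      ((\det (D e))^-1 * (\adj (D e)) b l) * xi (u e l))).
    move=> e We /=; have [v vF [tv ->]] := gP _ We.
    have [z vE] := spanF _ _ vF; have /unitD uD := We.
    have zE : z = y e.
      rewrite /y; have <- : z *m D e = delta_mx 0 b; last by rewrite mulmxK.
      by apply/rowP => a; rewrite -DP -vE tv mxE eqxx.
    rewrite vE linear_sum; apply: eq_bigr => l _; rewrite linearZ zE /y.
    by rewrite -rowE [row _ _ _ _]mxE /invmx uD /= !mxE.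
  apply: regular_sum => // l _; apply: regularM; [exact: oW' | | exact: ru].
  apply: regularM; [exact: oW' | exact: rV' | exact: regular_adj].
move=> F AF WF; have [v vF [tv ->]] := fP F AF; have [v' v'F [tv' ->]] := gP F WF.
have /WP W0 := WF; have vv' : v - v' = 0.
  apply: W0 => [|a]; first exact: memvB.
  by rewrite linearB /= tv tv' subrr.
by rewrite (subr0_eq vv').
Qed.

End FlagGeometry.

(** * Homogeneous Jordan bases *)

Section FreeFamilies.
Variables (k : fieldType) (T : vectType k).

Lemma free_subseq (X Y : seq T) : subseq X Y -> free Y -> free X.
Proof.
move=> XY fY; rewrite (elimT (subseq_uniqP (free_uniq fY)) XY).
exact: filter_free.
Qed.

(** Drawing the new vectors from [Y] itself is what keeps the completed basis of the kernel
    homogeneous. *)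
Lemma free_complete (X Y : seq T) : free X -> exists w,
  [/\ {subset w <= Y}, free (X ++ w) & <<X ++ w>>%VS = (<<X>> + <<Y>>)%VS].
Proof.
elim: Y X => [|y Y IHY] X fX.
  by exists [::]; split; rewrite ?cats0 // span_nil addv0.
have [yX|yX] := boolP (y \in <<X>>%VS).
  have [w [wY fw sw]] := IHY X fX; exists w; split=> //.
    by move=> v /wY; rewrite inE => ->; rewrite orbT.
  rewrite sw span_cons addvA; congr (_ + _)%VS; apply/esym/addv_idPl.
  by rewrite -memvE.
have [|w [wY fw sw]] := IHY (X ++ [:: y]).
  by rewrite (@perm_free _ _ _ (y :: X)) ?free_cons ?yX // perm_catC.
exists (y :: w); split.
- by move=> v; rewrite !inE => /predU1P[->|/wY->]; rewrite ?eqxx ?orbT.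
- by rewrite -cat1s catA.
- by rewrite -cat1s catA sw span_cat span_seq1 span_cons addvA.
Qed.

(** The forms are indexed by all of [I], with zero off [A], so that strings of different lengths can
    share one rectangular index type. *)
Lemma dual_family (I : finType) (A : {pred I}) (f : I -> T) (U : {vspace T}) :
    basis_of U [tuple f (enum_val a) | a < #|A|] ->
  exists chi : I -> 'Hom(T, k^o),
  [/\ forall z z', z' \in A -> chi z (f z') = (z == z')%:R,
      forall z, z \notin A -> chi z = 0 &
      forall v, v \in U -> v = \sum_z chi z v *: f z].
Proof.
set X := mktuple _; move=> bX; have fX := basis_free bX.
have XE (a : 'I_#|A|) : X`_a = f (enum_val a) by rewrite -tnth_nth tnth_mktuple.
pose chi z : 'Hom(T, k^o) :=
  \sum_(a < #|A| | enum_val a == z) linfun (coord X a : T -> k^o).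
have chiE z v : chi z v = \sum_(a < #|A| | enum_val a == z) coord X a v.
  by rewrite sum_lfunE; apply: eq_bigr => a _; rewrite lfunE.
exists chi; split.
- move=> z z' z'A; rewrite chiE -(enum_rankK_in z'A z'A) -XE.
  set a' := enum_rank_in _ _; under eq_bigr do rewrite coord_free //.
  rewrite big_mkcond (bigD1 a') //= eqxx big1 ?addr0 => [|a /negPf aa']; last first.
    by rewrite (eq_sym a' a) aa' if_same.
  by rewrite eq_sym; case: eqP.
- move=> z zA; rewrite /chi big1 // => a /eqP aE.
  by move: zA; rewrite -aE enum_valP.
- move=> v vU; rewrite [LHS](coord_basis bX vU).
  rewrite (partition_big (fun a => enum_val a) xpredT) //=.
  apply: eq_bigr => z _; rewrite chiE scaler_suml.
  by apply: eq_bigr => a /eqP <-; rewrite XE.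
Qed.

End FreeFamilies.

(** * Jordan strings of a graded nilpotent endomorphism *)

Section Jordan.
Variables (k : fieldType) (T : vectType k) (n : nat).
Variables (P : 'I_n -> 'End(T)) (R : 'End(T)).
Hypothesis PP : forall i x, P i (P i x) = P i x.
Hypothesis RP : forall i x, R (P i x) = P (ordS i) (R x).

Definition strings (s : seq (T * nat)) : seq T :=
  flatten [seq [seq iter u R p.1 | u <- iota 0 p.2] | p <- s].

Lemma size_strings s : size (strings s) = (\sum_(p <- s) p.2)%N.
Proof.
rewrite size_flatten /shape -map_comp sumnE big_map; apply: eq_bigr => p _.
by rewrite /= size_map size_iota.
Qed.

Lemma mem_strings s p u : p \in s -> (u < p.2)%N -> iter u R p.1 \in strings s.
Proof.
move=> ps up; apply/flattenP; exists [seq iter u R p.1 | u <- iota 0 p.2].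
  by apply/mapP; exists p.
by apply/mapP; exists u; rewrite // mem_iota.
Qed.

Lemma stringsP s x : x \in strings s ->
  exists p u, [/\ p \in s, (u < p.2)%N & x = iter u R p.1].
Proof.
move=> /flattenP[_ /mapP[p ps ->] /mapP[u]].
by rewrite mem_iota => up ->; exists p, u.
Qed.

(* Lift the strings of [R @: U] by one step and complete their last vectors to
   a homogeneous basis of the kernel of [R] on [U]. *)
Lemma jordan_strings N (U : {vspace T}) :
    (forall i x, x \in U -> P i x \in U) ->
    (forall x, x \in U -> R x \in U) ->
    (forall x, x \in U -> x = \sum_i P i x) ->
    (forall x, x \in U -> iter N R x = 0) ->
  exists s : seq (T * nat),
    [/\ forall p, p \in s -> exists i, P i p.1 = p.1,
        forall p, p \in s -> (0 < p.2)%N,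
        forall p, p \in s -> iter p.2 R p.1 = 0 &
        basis_of U (strings s)].
Proof.
elim: N U => [|N IHN] U PU RU sumU nilU.
  exists [::]; split=> //; rewrite (_ : U = 0%VS) ?nil_basis //.
  by apply/eqP; rewrite -subv0; apply/subvP => x /nilU /= ->; rewrite mem0v.
have [||||s [homs poss nils bas]] := IHN (R @: U)%VS.
- move=> i _ /memv_imgP[x xU ->]; rewrite -(ord_predK i) -RP memv_img //.
  exact: PU.
- by move=> _ /memv_imgP[x xU ->]; rewrite memv_img // RU.
- move=> _ /memv_imgP[x xU ->]; rewrite {1}[x]sumU // linear_sum.
  rewrite [RHS](reindex (@ordS n)) /=.
    by apply: eq_bigr => i _; rewrite RP.
  by apply: onW_bij; exact: ordS_bij.
- by move=> _ /memv_imgP[x xU ->]; rewrite -iterSr nilU.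
have sRU x : x \in strings s -> x \in (R @: U)%VS by exact: basis_mem.
have liftP p : exists t, p \in s -> [/\ t \in U, exists i, P i t = t & R t = p.1].
  have [ps|] := boolP (p \in s); last by exists 0.
  have /memv_imgP[x xU xE] := sRU _ (mem_strings ps (poss p ps)).
  have [i Pi] := homs p ps; exists (P (ord_pred i) x) => _; split; first exact: PU.
    by exists (ord_pred i).
  by rewrite RP ord_predK -Pi -xE.
have [lift liftE] := choice liftP.
pose s1 := [seq (lift p, p.2.+1) | p <- s].
(* These are the last vectors of the old strings, hence free and in the kernel of [R], and they are
   also the last vectors of the lifted strings. *)
pose bot := [seq iter p.2 R (lift p) | p <- s].
pose W := (U :&: lker R)%VS.
have iterR u x : R (iter u R x) = iter u R (R x) by rewrite -iterS iterSr.
have iterU u x : x \in U -> iter u R x \in U.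
  by move=> xU; elim: u => [//|u IHu]; apply: RU.
have fbot : free bot.
  apply: free_subseq (basis_free bas).
  have: {subset s <= s} by [].
  rewrite /bot /strings; elim: {1 3 4}s => [//|p s0 IH] /= ps.
  rewrite -cat1s; apply: cat_subseq.
    rewrite sub1seq; have p0 := ps p (mem_head _ _); have [_ _ liftp] := liftE p p0.
    apply/mapP; exists p.2.-1.
      by rewrite mem_iota leq0n add0n ltn_predL poss.
    by rewrite -liftp -iterSr prednK // poss.
  by apply: IH => q qs; apply: ps; rewrite inE qs orbT.
have botW : (<<bot>> <= W)%VS.
  apply/span_subvP => _ /mapP[p ps ->]; have [tU _ tE] := liftE p ps.
  by rewrite memv_cap iterU //= memv_ker iterR tE nils.
(* A homogeneous family spanning the kernel. *)
pose Y := flatten [seq (vbasis (P i @: W) : seq T) | i <- enum 'I_n].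
have [w [wY fw sw]] := free_complete Y fbot.
have PW i x : x \in W -> P i x \in W.
  rewrite !memv_cap !memv_ker RP => /andP[/PU-> /eqP->].
  by rewrite linear0 eqxx.
have spanW : <<bot ++ w>>%VS = W.
  rewrite sw (_ : <<Y>>%VS = W); first exact/addv_idPr.
  apply/eqP; rewrite eqEsubv; apply/andP; split.
    apply/span_subvP => x /flattenP[_ /mapP[i _ ->] /vbasis_mem].
    by move=> /memv_imgP[z zW ->]; exact: PW.
  apply/subvP => x xW; rewrite [x]sumU; last by move: xW; rewrite memv_cap => /andP[].
  apply: memv_suml => i _; have: P i x \in (P i @: W)%VS by rewrite memv_img.
  rewrite -{1}(span_basis (vbasisP (P i @: W)%VS)); move: (P i x); apply/subvP.
  apply/sub_span => z zi; apply/flattenP; exists (vbasis (P i @: W) : seq T) => //.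
  by apply/mapP; exists i; rewrite ?mem_enum.
exists (s1 ++ [seq (x, 1%N) | x <- w]); split.
- move=> p; rewrite mem_cat => /orP[] /mapP[q qs ->] /=.
    by have [] := liftE q qs.
  have /flattenP[_ /mapP[i _ ->] /vbasis_mem/memv_imgP[z _ ->]] := wY _ qs.
  by exists i.
- by move=> p; rewrite mem_cat => /orP[] /mapP[q qs ->].
- move=> p; rewrite mem_cat => /orP[] /mapP[q qs ->] /=.
    by have [_ _ tE] := liftE q qs; rewrite iterR tE nils.
  have : q \in W by rewrite -spanW memv_span // mem_cat qs orbT.
  by rewrite memv_cap memv_ker => /andP[_ /eqP].
have sub1 : {subset strings s1 <= strings (s1 ++ [seq (x, 1%N) | x <- w])}.
  by move=> x xs; rewrite /strings map_cat flatten_cat mem_cat xs.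
rewrite basisEdim; apply/andP; split.
  apply/subvP => x xU.
  have: R x \in (R @: <<strings s1>>)%VS.
    have: R x \in (R @: U)%VS by rewrite memv_img.
    rewrite -(span_basis bas); apply: subvP; apply/span_subvP => y.
    move=> /stringsP[p [u [ps up ->]]]; have [_ _ tE] := liftE p ps.
    rewrite -tE -iterR memv_img // memv_span //.
    by apply: (@mem_strings s1 (lift p, p.2.+1)); [apply/mapP; exists p | exact: ltnW].
  move=> /memv_imgP[z zs xz].
  have zU : z \in U.
    move: z zs {xz}; apply/subvP/span_subvP => y /stringsP[p [u [/mapP[q qs ->] _ ->]]].
    by apply: iterU; have [] := liftE q qs.
  rewrite -(subrK z x) memvD //; last first.
    by move: z zs {xz zU}; apply/subvP/sub_span.
  have : x - z \in W by rewrite memv_cap memvB // memv_ker linearB /= xz subrr.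
  rewrite -spanW; move: (x - z); apply/subvP/sub_span => y; rewrite mem_cat => /orP[].
    move=> /mapP[p ps ->]; apply: sub1.
    by apply: (@mem_strings s1 (lift p, p.2.+1)) => //; apply/mapP; exists p.
  move=> yw; apply: (@mem_strings _ (y, 1%N) 0) => //.
  by rewrite mem_cat; apply/orP; right; apply/mapP; exists y.
(* Rank-nullity: the old strings count the image, while the extra vector of each lifted string and
   the new strings of length 1 count the kernel. *)
rewrite size_strings big_cat !big_map /=.
rewrite -(limg_ker_dim R U) -/W -spanW (eqnP fw) size_cat /bot size_map.
rewrite -(span_basis bas) (eqnP (basis_free bas)) size_strings.
rewrite sum1_size addnAC leq_add2r -sum1_size -big_split leq_eqVlt.
by apply/orP; left; apply/eqP/eq_bigr => p _.
Qed.

End Jordan.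

(** Row [i] of a matrix holds the coordinates of a vector of [V i], padded by zeros. The matrix
    space may exceed the direct sum, which is why Jordan strings are constructed in a subspace
    [U]. *)
Lemma total_space (k : fieldType) n (V : 'I_n -> vectType k) :
  exists (T : vectType k) (inj : forall i, 'Hom(V i, T))
    (pr : forall i, 'Hom(T, V i)),
    (forall i v, pr i (inj i v) = v) /\
    (forall i j v, i != j -> pr i (inj j v) = 0).
Proof.
pose D := (\max_i \dim {: V i})%N; pose T := 'M[k]_(n, D.+1).
have lD i (l : 'I_(\dim {: V i})) : (l < D.+1)%N.
  by rewrite ltnS ltnW // (leq_trans (ltn_ord l)) // leq_bigmax.
pose w i l := Ordinal (lD i l).
pose inj i (v : V i) : T :=
  \sum_l coord (vbasis fullv) l v *: delta_mx i (w i l).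
pose pr i (x : T) : V i := \sum_l x i (w i l) *: (vbasis fullv)`_l.
have linj i : linear (@inj i).
  move=> a u v; rewrite /inj scaler_sumr -big_split; apply: eq_bigr => l _.
  by rewrite linearP scalerDl scalerA.
have lpr i : linear (@pr i).
  move=> a u v; rewrite /pr scaler_sumr -big_split; apply: eq_bigr => l _.
  by rewrite !mxE scalerDl scalerA.
pose injL i : {linear V i -> T} := HB.pack (@inj i)
  (GRing.isLinear.Build k (V i) T *:%R (@inj i) (linj i)).
pose prL i : {linear T -> V i} := HB.pack (@pr i)
  (GRing.isLinear.Build k T (V i) *:%R (@pr i) (lpr i)).
have prinj i j (v : V j) l : (inj j v) i (w i l) =
    \sum_l' coord (vbasis fullv) l' v * ((i == j) && (w i l == w j l'))%:R.
  by rewrite summxE; apply: eq_bigr => l' _; rewrite !mxE.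
exists T, (fun i => linfun (injL i)), (fun i => linfun (prL i)).
split=> [i v|i j v ij]; rewrite !lfunE /= /pr.
  rewrite [RHS](coord_vbasis (memvf v)); apply: eq_bigr => l _.
  rewrite prinj eqxx (bigD1 l) //= eqxx mulr1 big1 ?addr0 // => l' l'l.
  by rewrite -val_eqE /= val_eqE eq_sym (negPf l'l) mulr0.
rewrite big1 // => l _; rewrite prinj big1 ?scale0r // => l' _.
by rewrite (negPf ij) mulr0.
Qed.

(** [e i s u] is the component at vertex [i] of the vector of height [u] in the string [s]. It is
    defined for all [i] and all natural [u], with value 0 off the string, so that [rmap] raises [u]
    by one without a case distinction at the end of the string. *)
Lemma jordan_basis (k : fieldType) n (M : cyclic_rep k n) : nilpotent_rep M ->
  exists q L (len : 'I_q -> nat) (col : 'I_q -> 'I_n)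
    (e : forall i, 'I_q -> nat -> rspace M i)
    (chi : forall i, 'I_q * 'I_L -> 'Hom(rspace M i, k^o)),
  let valid i s u := (u < len s)%N && (iter u (@ordS n) (col s) == i) in
  [/\ forall s, (len s <= L)%N,
      forall i s u, rmap M i (e i s u) = e (ordS i) s u.+1,
      forall i s u, ~~ valid i s u -> e i s u = 0,
      forall i (b b' : 'I_q * 'I_L), chi i b (e i b'.1 b'.2) =
        (valid i b.1 b.2 && (b == b'))%:R &
      forall i v, v = \sum_b chi i b v *: e i b.1 b.2].
Proof.
move=> [N rN]; have [T [inj [pr [prinj prinj0]]]] := total_space (rspace M).
pose P i : 'End(T) := (inj i \o pr i)%VF.
pose R : 'End(T) := \sum_i (inj (ordS i) \o rmap M i \o pr i)%VF.
have PE i x : P i x = inj i (pr i x) by rewrite comp_lfunE.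
have RE x : R x = \sum_i inj (ordS i) (rmap M i (pr i x)).
  by rewrite sum_lfunE; apply: eq_bigr => i _; rewrite !comp_lfunE.
have Rinj i v : R (inj i v) = inj (ordS i) (rmap M i v).
  rewrite RE (bigD1 i) //= prinj big1 ?addr0 // => j ji.
  by rewrite prinj0 // !linear0.
have prR i x : pr (ordS i) (R x) = rmap M i (pr i x).
  rewrite RE linear_sum (bigD1 i) //= prinj big1 ?addr0 // => j ji.
  by rewrite prinj0 // (inj_eq (@ordS_inj n)) eq_sym.
have PP i x : P i (P i x) = P i x by rewrite !PE prinj.
have RP i x : R (P i x) = P (ordS i) (R x) by rewrite !PE Rinj prR.
pose U := (\sum_i limg (inj i))%VS.
have injU i v : inj i v \in U.
  by apply: subvP (memv_img _ (memvf v)); apply: (sumv_sup i).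
have UP x : x \in U -> exists v : forall i, rspace M i, x = \sum_i inj i (v i).
  move=> /memv_sumP[u uP ->].
  have vP i : exists v, u i = inj i v.
    by have /memv_imgP[v _ ->] := uP i isT; exists v.
  exists (fun i => projT1 (cid (vP i))); apply: eq_bigr => i _.
  by case: (cid (vP i)).
have sumU x : x \in U -> x = \sum_i P i x.
  move=> /UP[v ->]; apply: eq_bigr => i _; rewrite PE; congr (inj i _).
  rewrite linear_sum (bigD1 i) //= prinj big1 ?addr0 // => j ji.
  by rewrite prinj0 // eq_sym.
have iterRinj u i v : iter u R (inj i v) = inj (iter u (@ordS n) i) (rpath M u i v).
  elim: u => [|u IHu] /=; first by rewrite id_lfunE.
  by rewrite IHu Rinj comp_lfunE.
have nilU x : x \in U -> iter N R x = 0.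
  have iter_sum (F : 'I_n -> T) : iter N R (\sum_i F i) = \sum_i iter N R (F i).
    by elim: N {rN} => [//|u IHu] /=; rewrite IHu linear_sum.
  move=> /UP[v ->]; rewrite iter_sum big1 // => i _.
  by rewrite iterRinj rN zero_lfunE linear0.
have PU i x : x \in U -> P i x \in U by rewrite PE.
have RU x : x \in U -> R x \in U.
  by move=> _; rewrite RE; apply: memv_suml.
have [s [homs poss nils bas]] := jordan_strings PP RP PU RU sumU nilU.
pose q := size s; pose L := (\max_(p <- s) p.2)%N.
pose p0 (a : 'I_q) := tnth (in_tuple s) a.
have p0s a : p0 a \in s by exact: mem_tnth.
have [col colP] := choice (fun a => homs _ (p0s a)).
pose len a := (p0 a).2; pose e i a u := pr i (iter u R (p0 a).1).
have lenL a : (len a <= L)%N.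
  by rewrite /L big_tnth (leq_bigmax (F := fun a => (tnth (in_tuple s) a).2)).
have iterP u a : P (iter u (@ordS n) (col a)) (iter u R (p0 a).1) = iter u R (p0 a).1.
  by elim: u => [|u IHu] /=; [exact: colP | rewrite -RP IHu].
have R0 v : iter v R 0 = 0 by elim: v => [//|v IHv]; rewrite iterS IHv linear0.
have e0 i a u : ~~ ((u < len a)%N && (iter u (@ordS n) (col a) == i)) -> e i a u = 0.
  rewrite negb_and => /orP[]; rewrite /e.
    rewrite -leqNgt => /subnKC <-.
    by rewrite addnC iterD nils // R0 linear0.
  by move=> ii; rewrite -iterP PE prinj0 // eq_sym.
pose A : {pred 'I_q * 'I_L} := [pred z : 'I_q * 'I_L | (z.2 < len z.1)%N].
pose f (z : 'I_q * 'I_L) := iter z.2 R (p0 z.1).1.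
have [|chi [chiE _ chi_sum]] := @dual_family k T _ A f U.
  rewrite basisEdim; apply/andP; split.
    rewrite -(span_basis bas); apply: sub_span => x /stringsP[p [u [ps up ->]]].
    have /tnthP[a pE] : p \in in_tuple s by [].
    have uL : (u < L)%N by apply: leq_trans (lenL a); rewrite /len /p0 -pE.
    have zA : (a, Ordinal uL) \in A by rewrite inE /= /len /p0 -pE.
    apply/mapP; exists (enum_rank_in zA (a, Ordinal uL)).
      by rewrite mem_enum.
    by rewrite enum_rankK_in // /f /= /p0 -pE.
  rewrite size_tuple -(span_basis bas) (eqnP (basis_free bas)) size_strings.
  rewrite -sum1_card (eq_bigl (fun z : 'I_q * 'I_L => true && (z.2 < len z.1)%N)) //.
  rewrite -(pair_big_dep xpredT (fun a (u : 'I_L) => (u < len a)%N) (fun _ _ => 1%N)) /=.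
  rewrite (big_tnth _ _ s) leq_sum // => a _.
  by rewrite (big_ord_narrow (F := fun=> 1%N) (lenL a)) sum1_card card_ord.
pose valid i a u := (u < len a)%N && (iter u (@ordS n) (col a) == i).
exists q, L, len, col, e, (fun i (z : 'I_q * 'I_L) =>
  if valid i z.1 z.2 then (chi z \o inj i)%VF else 0).
split=> // [i a u|i z z'|i v].
- by rewrite /e -prR.
- rewrite -/(valid _ _ _); have [vz|nvz] := boolP (valid i z.1 z.2); last first.
    by rewrite zero_lfunE.
  rewrite comp_lfunE; have [vz'|nvz'] := boolP (valid i z'.1 z'.2); last first.
    rewrite e0 // !linear0; case: eqP => // zz'.
    by rewrite -zz' vz in nvz'.
  have /andP[z'A /eqP iE] := vz'.
  by rewrite /e -PE -[X in P X]iE iterP -/(f z') chiE.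
rewrite -[LHS](prinj i) {1}(chi_sum _ (injU i v)) linear_sum.
apply: eq_bigr => z _; rewrite linearZ /= -/(e i z.1 z.2).
have [vz|nvz] := boolP (valid i z.1 z.2); first by rewrite comp_lfunE.
by rewrite e0 // !scaler0.
Qed.

(** * Flags of a representation *)

Lemma iter_injective (T : Type) (f : T -> T) d :
  injective f -> injective (iter d f).
Proof. by move=> f_inj; elim: d => [|d IHd] x y //= /f_inj /IHd. Qed.

(** * Stratification by semicontinuous functions *)

Section PavedLevels.
Variables (k : fieldType) (E : Type) (N : nat) (c : E -> 'I_N -> k).
Variables (Y : Type) (pi : E -> Y).
Let X : fspace k := quotient_space (X := zariski c) pi.
Let pav := @paved k E N c Y pi.

(** Inside the locus [f <= r.+1] the locus [f <= r] is open with complement [f = r.+1], so the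
    strata are split off by decreasing value. *)
Lemma paved_level (f : X -> nat) bnd (A : set X) :
    (forall r, fopen [set x | (f x <= r)%N]) -> (forall x, (f x <= bnd)%N) ->
    (forall r, pav (A `&` [set x | f x = r])) ->
  pav A.
Proof.
move=> of_ fb pf.
have pl r : pav (A `&` [set x | (f x <= r)%N]).
  elim: r => [|r IHr].
    rewrite (_ : [set x | _] = [set x | f x = 0%N]) //.
    by apply/seteqP; split=> x /=; rewrite leqn0 => /eqP.
  apply: (paved_split (of_ r)).
    rewrite (_ : _ `\` _ = A `&` [set x | f x = r.+1]); first exact: pf.
    apply/seteqP; split=> x [] /=.
      move=> [Ax le] /negP; rewrite -ltnNge => lt; split=> //.
      by apply/eqP; rewrite eqn_leq le.
    by move=> Ax ->; split=> //; apply/negP; rewrite -ltnNge.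
  rewrite (_ : _ `&` [set x | (f x <= r)%N] = A `&` [set x | (f x <= r)%N]).
    exact: IHr.
  apply/seteqP; split=> x [] /=; first by move=> [].
  by move=> Ax le; split=> //; split=> //; exact: ltnW.
rewrite (_ : A = A `&` [set x | (f x <= bnd)%N]); first exact: pl.
by apply/seteqP; split=> x; [move=> Ax; split=> //=; exact: fb | case].
Qed.

(** A stratum is named by one of its points [x0], which discards empty strata and supplies the flag
    from which pivots are read off later. *)
Lemma paved_levels (I : eqType) (f : I -> X -> nat) (bnd : I -> nat) (l : seq I)
    (A : set X) :
    (forall i r, fopen [set x | (f i x <= r)%N]) ->
    (forall i x, (f i x <= bnd i)%N) ->
    (forall x0, A x0 -> pav (A `&` [set x | forall i, i \in l -> f i x = f i x0])) ->
  pav A.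
Proof.
move=> of_ fb; elim: l A => [|i l IHl] A pf.
  have [[x0 Ax0]|A0] := pselect (exists x, A x).
    have := pf x0 Ax0; rewrite (_ : _ `&` _ = A) //.
    by apply/seteqP; split=> x; [case | move=> Ax; split].
  have -> : A = set0; last exact: paved0.
  by apply/seteqP; split=> x // Ax; apply: A0; exists x.
apply: (paved_level (of_ i) (fb i)) => r; apply: IHl => x0 [Ax0 fx0].
have := pf x0 Ax0; rewrite (_ : _ `&` _ =
  A `&` [set x | f i x = r] `&` [set x | forall j, j \in l -> f j x = f j x0]) //.
apply/seteqP; split=> x.
  move=> [Ax fx]; split; first by split=> //=; rewrite fx ?mem_head.
  by move=> j jl; apply: fx; rewrite inE jl orbT.
move=> [[Ax fx] fl]; split=> // j; rewrite inE => /predU1P[->|/fl //].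
by rewrite fx fx0.
Qed.

Lemma paved_singleton (A : set X) : (forall x, exists e, pi e = x) ->
  (forall x y, A x -> A y -> x = y) -> pav A.
Proof.
move=> pi_surj A1; have [[x0 Ax0]|A0] := pselect (exists x, A x); last first.
  have -> : A = set0; last exact: paved0.
  by apply/seteqP; split=> x // Ax; apply: A0; exists x.
have [e0 e0E] := pi_surj x0; apply: paved_cell.
exists 0%N, (fun=> e0), (fun=> 0); split=> [a|_|x Ax|y|[] //].
- by apply: regular_cst; exact: fopenT.
- by rewrite e0E.
- by rewrite e0E; exact: A1.
- by apply/rowP => -[].
Qed.

End PavedLevels.

(** * Coordinate subspaces and maps between strings *)

Section CyclicFlags.
Variables (k : fieldType) (n : nat) (M : cyclic_rep k n).
Variable dd : composition (dimvec (rspace M)).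
Let V := rspace M.
Let m := clen dd.
Let X := flag_variety dd.

Variables (q L : nat) (len : 'I_q -> nat) (col : 'I_q -> 'I_n).
Let I : finType := ('I_q * 'I_L)%type.
Variables (e : forall i, 'I_q -> nat -> V i) (chi : forall i, I -> 'Hom(V i, k^o)).
Let valid i s u := (u < len s)%N && (iter u (@ordS n) (col s) == i).
Hypothesis lenL : forall s, (len s <= L)%N.
Hypothesis rmap_e : forall i s u, rmap M i (e i s u) = e (ordS i) s u.+1.
Hypothesis e_invalid : forall i s u, ~~ valid i s u -> e i s u = 0.
Hypothesis chi_e0 : forall i (b b' : I), chi i b (e i b'.1 b'.2) =
  (valid i b.1 b.2 && (b == b'))%:R.
Hypothesis e_sum : forall i v, v = \sum_b chi i b v *: e i b.1 b.2.

Let ee i (b : I) := e i b.1 b.2.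
Let vb i (b : I) := valid i b.1 b.2.

Lemma chi_e i b s u : chi i b (e i s u) =
  [&& vb i b, b.1 == s & b.2 == u :> nat]%:R.
Proof.
have [uL|Lu] := ltnP u L.
  by rewrite (chi_e0 i b (s, Ordinal uL)) -/(vb i b); case: b => b1 b2.
rewrite e_invalid ?linear0; last first.
  by rewrite /valid ltnNge (leq_trans (lenL s) Lu).
by rewrite [_ == u]ltn_eqF ?andbF // (leq_trans (ltn_ord _) Lu).
Qed.

Lemma chi_ee i b b' : chi i b (ee i b') = (vb i b && (b == b'))%:R.
Proof. exact: chi_e0. Qed.

Lemma chi_valid i b v : chi i b v != 0 -> vb i b.
Proof.
apply: contraNT => nvb; rewrite [v in chi _ _ v]e_sum linear_sum big1 // => b' _.
by rewrite linearZ /= -/(ee i b') chi_ee (negPf nvb) scaler0.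
Qed.

Definition cspan i (S : {set I}) : {vspace V i} := (\sum_(b in S) <[ee i b]>)%VS.

Lemma cspanP i (S : {set I}) v :
  reflect (forall b, chi i b v != 0 -> b \in S) (v \in cspan i S).
Proof.
apply: (iffP idP) => [/memv_sumP[u uS ->] b|vS].
  apply: contraNT => bS; rewrite linear_sum big1 // => b' b'S.
  have /vlineP[a ->] := uS _ b'S.
  rewrite linearZ /= chi_ee; case: (eqVneq b b') => [bb'|_].
    by rewrite bb' b'S in bS.
  by rewrite andbF scaler0.
rewrite [v]e_sum; apply: memv_suml => b _.
have [->|/vS bS] := eqVneq (chi i b v) 0; first by rewrite scale0r mem0v.
rewrite memvZ //; apply: subvP (memv_line _).
exact: (sumv_sup b).
Qed.

Lemma e_cspan i (S : {set I}) s u :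
  (forall b, vb i b -> b.1 = s -> b.2 = u :> nat -> b \in S) -> e i s u \in cspan i S.
Proof.
move=> bS; apply/cspanP => b; rewrite chi_e.
by case: and3P => [[vbi /eqP bs /eqP bu] _|_]; [exact: bS | rewrite eqxx].
Qed.

Lemma ee_cspan i (S : {set I}) b : b \in S -> ee i b \in cspan i S.
Proof.
move=> bS; apply: e_cspan => b' _ b1 b2; rewrite (_ : b' = b) //.
by move: b1 b2; case: b' => ? ?; case: (b) => ? ? /= -> /val_inj ->.
Qed.

Lemma ee_cspan_valid i (S : {set I}) b : vb i b -> ee i b \in cspan i S -> b \in S.
Proof.
by move=> vbi /cspanP/(_ b); apply; rewrite chi_ee vbi eqxx oner_neq0.
Qed.

Lemma cspan_sub i (S : {set I}) (W : {vspace V i}) :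
  (forall b, b \in S -> vb i b -> ee i b \in W) -> (cspan i S <= W)%VS.
Proof.
move=> SW; apply/subv_sumP => b bS; rewrite -memvE.
have [/SW->//|nvb] := boolP (vb i b).
by rewrite /ee e_invalid ?mem0v.
Qed.

Lemma chi_rmap i (b b' : I) v : vb (ordS i) b' -> b'.1 = b.1 -> b'.2 = b.2.+1 :> nat ->
  chi (ordS i) b' (rmap M i v) = chi i b v.
Proof.
move=> vb' b1 b2; rewrite {1}[v]e_sum !linear_sum (bigD1 b) //= big1 ?addr0.
  by rewrite !linearZ /= rmap_e chi_e vb' b1 b2 !eqxx /= [_ *: _]mulr1.
move=> b0 b0b; rewrite !linearZ /= rmap_e chi_e vb' b1 b2 /= eqSS.
rewrite (_ : _ && _ = false) ?scaler0 //; apply/negP => /andP[/eqP e1 /eqP/val_inj e2].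
by move/eqP: b0b; apply; case: b0 e1 e2 {b1 b2} => ? ?; case: b => ? ? /= -> ->.
Qed.

(* Ordering by [b.2] first makes raising maps [raise] below increase [key]. *)
Definition key (b : I) : nat := (b.2 * q + b.1)%N.

Lemma key_inj : injective key.
Proof.
move=> [b1 b2] [c1 c2]; rewrite /key /= => eq_key.
have q0 : (0 < q)%N by apply: leq_trans (ltn_ord b1).
congr (_, _); apply: val_inj => /=.
  have := congr1 (modn^~ q) eq_key.
  by rewrite /= !modnMDl !modn_small.
have := congr1 (divn^~ q) eq_key.
by rewrite /= !divnMDl // !divn_small // !addn0.
Qed.

Lemma key_lt (b b' : I) : (key b < key b')%N -> (b.2 <= b'.2)%N.
Proof.
rewrite /key; apply: contraTT; rewrite -!ltnNge => lt; rewrite ltnS.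
apply: (@leq_trans (b'.2.+1 * q)); last first.
  by rewrite (leq_trans _ (leq_addr _ _)) // leq_mul2r lt orbT.
by rewrite mulSn addnC leq_add2r ltnW.
Qed.

Definition raise_fun (p : I * I) i (v : V i) : V i :=
  \sum_(w : 'I_L | (w <= p.1.2)%N)
    chi i (p.1.1, w) v *: e i p.2.1 (w + (p.2.2 - p.1.2))%N.

Lemma raise_linear p i : linear (@raise_fun p i).
Proof.
move=> a u v; rewrite /raise_fun scaler_sumr -big_split; apply: eq_bigr => w _.
by rewrite linearP scalerDl scalerA.
Qed.

HB.instance Definition _ p i :=
  GRing.isLinear.Build k (V i) (V i) *:%R (@raise_fun p i) (@raise_linear p i).

(* The endomorphism moving the string through [p.1], up to [p.1], onto the
   string through [p.2]. *)
Definition raise p i : 'End(V i) := linfun (@raise_fun p i).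

(** Equal vertices make the shift respect the grading. The height inequality makes [p.2.2 - p.1.2] a
    genuine difference, so that the beginning of the source string is shifted too. *)
Definition good_pair (p : I * I) :=
  [/\ (p.1.2 < len p.1.1)%N, 
      iter p.1.2 (@ordS n) (col p.1.1) = iter p.2.2 (@ordS n) (col p.2.1) &
      (p.1.2 <= p.2.2)%N].

Lemma raiseE p i s u : good_pair p -> raise p i (e i s u) =
  if (s == p.1.1) && (u <= p.1.2)%N then e i p.2.1 (u + (p.2.2 - p.1.2))%N else 0.
Proof.
case: p => [[b1 b2] [c1 c2]] [/= b2len colE le]; rewrite lfunE /= /raise_fun /=.
case: ifP => [/andP[/eqP-> ub]|nsu].
  have uL : (u < L)%N by apply: leq_ltn_trans ub (ltn_ord _).
  rewrite (bigD1 (Ordinal uL)) //= big1 ?addr0; last first.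
    move=> w /andP[_ wu]; rewrite chi_e /= (_ : (_ == u :> nat) = false).
      by rewrite !andbF scale0r.
    by apply/negbTE; rewrite -val_eqE in wu.
  rewrite chi_e /= !eqxx !andbT /vb /valid /= (leq_ltn_trans ub b2len) /=.
  case: eqP => [|ni]; first by rewrite scale1r.
  (* If the source vector does not live at [i], neither does its target: the two strings run through
     the same vertices after the shift, as [ordS] is injective. *)
  rewrite scale0r e_invalid // /valid negb_and; apply/orP; right; apply/eqP => ci.
  apply: ni; apply: (iter_injective (d := (b2 - u)%N) (@ordS_inj n)).
  rewrite -iterD subnK // colE -ci -iterD; congr (iter _ _ _).
  by rewrite addnA subnK // subnKC.
rewrite big1 // => w wb; rewrite chi_e /=.
case: and3P => [[_ /eqP bs /eqP wu]|]; last by rewrite scale0r.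
by move: nsu; rewrite -bs eqxx -wu wb.
Qed.


Lemma flag_le (F : X) (l l' : 'I_m.+1) i :
  (l <= l')%N -> (\val F l i <= \val F l' i)%VS.
Proof.
have [_ _ Fsub _] : is_flag (dd := dd) (\val F) by have := valP F; rewrite in_setE.
case: l' => l'; elim: l' => [|l' IHl'] lt /=.
  by rewrite leqn0 => /eqP l0; rewrite (_ : l = Ordinal lt) //; apply: val_inj.
rewrite leq_eqVlt => /predU1P[ll'|].
  by rewrite (_ : l = Ordinal lt) //; exact: val_inj.
rewrite ltnS => ll'; apply: subv_trans (IHl' (ltnW lt) ll') _.
have lt' : (l' < m)%N by [].
have := Fsub (Ordinal lt') i.
rewrite (_ : lift _ _ = Ordinal lt); last exact: val_inj.
by rewrite (_ : widen_ord _ _ = Ordinal (ltnW lt)); last exact: val_inj.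
Qed.

Lemma flag0 (F : X) i : \val F ord0 i = 0%VS.
Proof. by have [->] : is_flag (dd := dd) (\val F) by have := valP F; rewrite in_setE. Qed.

Lemma strictly_stable_img (F : X) (l l' : 'I_m.+1) i :
    strictly_stable (dd := dd) F -> (l <= l'.+1)%N ->
  (rmap M i @: \val F l i <= \val F l' (ordS i))%VS.
Proof.
move=> Fs; case: (unliftP ord0 l) => [l1 ->|->] ll'; last by rewrite flag0 limg0 sub0v.
by apply: subv_trans (Fs l1 i) _; apply: flag_le.
Qed.

(** The sets of the descending induction: with [S 0] empty, [j = 0] gives all strictly stable flags,
    while [j = m] leaves at most one flag. *)
Definition fixed_flags (j : nat) (S : nat -> {set I}) : set X :=
  [set F | strictly_stable (dd := dd) F /\
    forall (l : 'I_m.+1) i, (l <= j)%N -> \val F l i = cspan i (S l)].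

(** * Moves between ends of strings over a fixed stable subspace *)

Section Step.
Variables (j : 'I_m) (S : nat -> {set I}) (F0 : X).
Hypothesis F0A : fixed_flags j S F0.
Let T := S j.
Let J0 := widen_ord (leqnSn m) j.
Let J1 : 'I_m.+1 := lift ord0 j.

Let cl (b : I) := iter b.2 (@ordS n) (col b.1).

Lemma fixed_flagsT F i : fixed_flags j S F -> \val F J0 i = cspan i T.
Proof. by move=> [_ ->]. Qed.

Lemma cspanT_stable i v : v \in cspan i T -> rmap M i v \in cspan (ordS i) T.
Proof.
rewrite -!(fixed_flagsT _ F0A) => vF; have [F0s _] := F0A.
have := strictly_stable_img (l := J0) (l' := J0) i F0s (leqnSn _).
by move/subvP; apply; rewrite memv_img.
Qed.

Lemma e_cspanT i s u d : e i s u \in cspan i T ->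
  e (iter d (@ordS n) i) s (u + d) \in cspan (iter d (@ordS n) i) T.
Proof.
by elim: d => [|d IHd] eT; rewrite ?addn0 // addnS /= -rmap_e cspanT_stable // IHd.
Qed.

(* The basis of the kernel of the map induced on the quotient by [cspan T]. *)
Definition socle (b : I) := [&& (b.2 < len b.1)%N, b \notin T &
  e (ordS (cl b)) b.1 b.2.+1 \in cspan (ordS (cl b)) T].

(** By stability the string lies in [cspan T] from the successor of a socle element onwards, and a
    socle element is not in [T]; hence a string has at most one. *)
Lemma socle_inj b b' : socle b -> socle b' -> b.1 = b'.1 -> b = b'.
Proof.
have lt_contra (c c' : I) : socle c -> socle c' -> c.1 = c'.1 -> ~ (c.2 < c'.2)%N.
  move=> /and3P[_ _ cT] /and3P[c'B /negP c'T _] cc' lt; apply: c'T.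
  have := e_cspanT (c'.2 - c.2.+1) cT; rewrite /cl -iterS -iterD subnK // subnKC //.
  by rewrite cc'; apply: ee_cspan_valid; rewrite /vb /valid c'B eqxx.
move=> sb sb' eq1; have /negP := lt_contra _ _ sb sb' eq1.
have /negP := lt_contra _ _ sb' sb (esym eq1); rewrite -!leqNgt => le le'.
have eq2 : b.2 = b'.2 by apply/val_inj/eqP; rewrite eqn_leq le le'.
by case: b b' eq1 eq2 {sb sb' le le'} => ? ? [? ?] /= -> ->.
Qed.

Section Unipotent.
Variable C : {set I}.

(** The free entries of a reduced echelon form: row of the pivot [p.1], column of the later
    non-pivot [p.2], restricted to ends of strings at one vertex. *)
Definition moves : {set I * I} := [set p : I * I |
  [&& p.1 \in C, p.2 \notin C, socle p.1 & socle p.2] &&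
  ((cl p.1 == cl p.2) && (key p.1 < key p.2)%N)].

Lemma movesP p : reflect
  ([/\ p.1 \in C, p.2 \notin C, socle p.1 & socle p.2] /\
   cl p.1 = cl p.2 /\ (key p.1 < key p.2)%N) (p \in moves).
Proof.
rewrite inE; apply: (iffP andP) => [[/and4P[? ? ? ?] /andP[/eqP ? ?]]|] //.
by move=> [[? ? ? ?] [? ?]]; split; [apply/and4P | apply/andP; split=> //; apply/eqP].
Qed.

Lemma moves_good p : p \in moves -> good_pair p.
Proof.
move=> /movesP[[_ _ /and3P[B1 _ _] _] [clE lt]]; split=> //.
exact: key_lt.
Qed.

Lemma linear_ee (W : vectType k) (U : {vspace W}) i (f : 'Hom(V i, W)) :
  (forall b, f (ee i b) \in U) -> forall v, f v \in U.
Proof.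
move=> fU v; rewrite [v]e_sum linear_sum; apply: memv_suml => b _.
by rewrite linearZ memvZ // fU.
Qed.

(** A basis vector of [cspan T] on the moved part of the string would force [p.1] into [T] by
    stability. *)
Lemma raise_cspanT p i v : p \in moves -> v \in cspan i T -> raise p i v = 0.
Proof.
move=> pm vT; suff: (cspan i T <= lker (raise p i))%VS.
  by move/subvP/(_ v vT); rewrite memv_ker => /eqP.
apply: cspan_sub => b bT vbi; rewrite memv_ker raiseE; last exact: moves_good.
case: ifP => // /andP[/eqP b1 b2]; move: pm => /movesP[[_ _ /and3P[pB + _] _] _].
case/negP; have := e_cspanT (p.1.2 - b.2) (ee_cspan i bT).
rewrite subnKC // b1; apply: ee_cspan_valid; rewrite /vb /valid pB.
by have /andP[_ /eqP<-] := vbi; rewrite -iterD subnK // b1 eqxx.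
Qed.

(** The two composites differ only at [p.1], where one gives 0 and the other the successor of [p.2],
    which lies in [cspan T] because [p.2] is in the socle. *)
Lemma raise_rmap p i v : p \in moves ->
  rmap M i (raise p i v) - raise p (ordS i) (rmap M i v) \in cspan (ordS i) T.
Proof.
move=> pm; have gp := moves_good pm.
rewrite -!comp_lfunE -opp_lfunE -add_lfunE; apply: linear_ee => b.
rewrite add_lfunE opp_lfunE !comp_lfunE rmap_e !raiseE //.
have [b1|_] := eqVneq b.1 p.1.1; last by rewrite linear0 subrr mem0v.
have [b2|b2|b2] := ltngtP b.2 p.1.2.
- by rewrite rmap_e -addSn subrr mem0v.
- by rewrite linear0 subrr mem0v.
rewrite subr0 rmap_e b2 subnKC; last by case: gp.
have /movesP[[_ _ _ /and3P[_ _ eT]] _] := pm.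
have [<- //|ni] := eqVneq (cl p.2) i.
rewrite e_invalid ?mem0v // /valid negb_and; apply/orP; right.
by rewrite iterS (inj_eq (@ordS_inj n)).
Qed.

(** A nonzero product would put [p'.2] and [p.1] on one string; both are in the socle, hence equal,
    yet only [p.1] is in [C]. *)
Lemma raise_comp0 p p' i : p \in moves -> p' \in moves ->
  (raise p i \o raise p' i)%VF = 0.
Proof.
move=> pm p'm; apply/lfunP => v; rewrite zero_lfunE; apply/eqP; rewrite -memv0.
apply: linear_ee => b; rewrite comp_lfunE raiseE; last exact: moves_good.
case: ifP => _; last by rewrite linear0 mem0v.
rewrite raiseE; last exact: moves_good.
case: ifP => [/andP[/eqP pp' _]|]; last by rewrite mem0v.
move: pm p'm => /movesP[[p1C _ s1 _] _] /movesP[[_ + _ s2] _].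
by rewrite (socle_inj s2 s1 pp') p1C.
Qed.

Definition moving (a : 'I_#|moves|) i : 'End(V i) := raise (enum_val a) i.

Lemma moving_comp0 a b i : (moving a i \o moving b i)%VF = 0.
Proof. by apply: raise_comp0; exact: enum_valP. Qed.

Let g := unip moving.
Let gF := unip_flag (dd := dd) moving_comp0.

Lemma unip_cspanT y i v : v \in cspan i T -> g y i v = v.
Proof.
move=> vT; rewrite /g unipE big1 ?addr0 // => a _.
by rewrite /moving raise_cspanT ?scaler0 //; exact: enum_valP.
Qed.

Lemma unip_img_cspanT y i (U : {vspace V i}) :
  (U <= cspan i T)%VS -> (g y i @: U)%VS = U.
Proof.
move=> UT; rewrite -[RHS]lim1g; apply: eq_in_limg => v vU.
by rewrite id_lfunE unip_cspanT //; exact: subvP vU.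
Qed.

(** Up to step [j] everything lies in [cspan T], on which [g y] is the identity. From there on the
    target step contains [cspan T], which absorbs the failure of [g y] to commute with [rmap]. *)
Lemma fixed_flags_unip y F : fixed_flags j S F -> fixed_flags j S (gF y F).
Proof.
move=> FA; have [Fs FS] := FA.
have leT (l : 'I_m.+1) i : (l <= j)%N -> (\val F l i <= cspan i T)%VS.
  by move=> lj; rewrite -(fixed_flagsT _ FA) flag_le.
split=> [l i|l i lj] /=; last by rewrite unip_img_cspanT ?FS // -FS // leT.
have [lj|jl] := ltnP l j.
  by rewrite !unip_img_cspanT ?leT ?Fs //= ltnW.
apply/subvP => _ /memv_imgP[_ /memv_imgP[w wF ->] ->].
rewrite -(subrK (g y (ordS i) (rmap M i w)) (rmap M i _)) memvD //; last first.
  by apply: memv_img; have /subvP := Fs l i; apply; rewrite memv_img.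
have: (cspan (ordS i) T <= g y (ordS i) @: \val F (widen_ord (leqnSn m) l) (ordS i))%VS.
  rewrite -(unip_img_cspanT y (subvv _)) limgS // -(fixed_flagsT _ FA).
  exact: flag_le.
move/subvP; apply; rewrite /g !unipE linearD linear_sum /= opprD addrACA subrr add0r.
rewrite -sumrB; apply: memv_suml => a _.
by rewrite linearZ /= -scalerBr memvZ // raise_rmap //; exact: enum_valP.
Qed.

End Unipotent.

(** * Levels, pivots and echelon vectors *)

Definition upper (c : bool) (b : I) : {set I} := [set b' | (key b + c <= key b')%N].

(** The Boolean tells whether [b] itself is excluded from the upper set. A drop between the two
    values means that some vector of the step has [b] as its lowest index, so levels determine the
    pivots and thus the Schubert cell. *)
Definition level (bc : I * bool) (F : X) : nat :=
  \dim (\val F J1 (cl bc.1) :&: cspan (cl bc.1) (upper bc.2 bc.1)).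

Let Y : set X := fixed_flags j S `&` [set F | forall bc, level bc F = level bc F0].

Definition pivots : {set I} :=
  [set b : I | (b.2 < len b.1)%N && (level (b, false) F0 != level (b, true) F0)].
Let C := pivots.

Lemma vb_cl i (b : I) : vb i b -> cl b = i.
Proof. by case/andP => _ /eqP. Qed.

Lemma eq_chi i v w : (forall b, chi i b v = chi i b w) -> v = w.
Proof. by move=> vw; rewrite [v]e_sum [w]e_sum; apply: eq_bigr => b _; rewrite vw. Qed.

Lemma cspanS i (S1 S2 : {set I}) : S1 \subset S2 -> (cspan i S1 <= cspan i S2)%VS.
Proof.
move=> /fintype.subsetP S12; apply: cspan_sub => b /S12 bS _.
exact: ee_cspan.
Qed.

Lemma pivotP F i (b : I) v : Y F -> v \in \val F J1 i -> chi i b v != 0 ->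
  (forall b', chi i b' v != 0 -> (key b <= key b')%N) -> b \in C.
Proof.
move=> [_ YF] vF cb low; have vbi := chi_valid cb; have ci := vb_cl vbi.
subst i; rewrite inE -!YF; apply/andP; split; first by case/andP: vbi.
apply/eqP => lev_eq.
have sub : (cspan (cl b) (upper true b) <= cspan (cl b) (upper false b))%VS.
  by apply: cspanS; apply/fintype.subsetP => b'; rewrite !inE addn0 addn1 => /ltnW.
have /eqP capE : (\val F J1 (cl b) :&: cspan (cl b) (upper true b) ==
    \val F J1 (cl b) :&: cspan (cl b) (upper false b))%VS.
  by rewrite eqEdim capvS //=; move: lev_eq; rewrite /level /= => ->.
have : v \in (\val F J1 (cl b) :&: cspan (cl b) (upper false b))%VS.
  rewrite memv_cap vF; apply/cspanP => b' /low; by rewrite inE addn0.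
rewrite -capE memv_cap => /andP[_ /cspanP/(_ b cb)].
by rewrite inE addn1 ltnn.
Qed.

Lemma pivot_lead F i (b : I) : Y F -> b \in C -> vb i b -> exists v,
  [/\ v \in \val F J1 i, chi i b v = 1 &
     forall b', chi i b' v != 0 -> (key b <= key b')%N].
Proof.
move=> [_ YF] bC /vb_cl ci; subst i; move: bC; rewrite inE -!YF => /andP[_].
rewrite /level /=; set U0 := (_ :&: _)%VS; set U1 := (_ :&: _)%VS => dimU.
have /subvPn[v] : ~~ (U0 <= U1)%VS.
  apply: contra dimU => le01; rewrite eqn_leq (dimvS le01) dimvS // capvS //.
  by apply: cspanS; apply/fintype.subsetP => b'; rewrite !inE addn0 addn1 => /ltnW.
rewrite !memv_cap => /andP[vF /cspanP v0]; rewrite vF /= => v1.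
have low b' : chi (cl b) b' v != 0 -> (key b <= key b')%N.
  by move=> /v0; rewrite inE addn0.
have cb : chi (cl b) b v != 0.
  apply: contra v1 => /eqP cb; apply/cspanP => b' cb'; rewrite inE addn1.
  rewrite ltn_neqAle low // andbT; apply/eqP => /key_inj bb'.
  by rewrite -bb' cb eqxx in cb'.
exists ((chi (cl b) b v)^-1 *: v); split; first by rewrite memvZ.
  by rewrite linearZ /= [_ *: _]mulVf.
move=> b'; rewrite linearZ /= => cb'; apply: low.
by apply: contra_neq cb' => ->; rewrite scaler0.
Qed.

Lemma pivot_eq0 F i v : Y F -> v \in \val F J1 i ->
  (forall b, b \in C -> chi i b v = 0) -> v = 0.
Proof.
move=> YF vF v0; apply: eq_chi => b0; rewrite linear0; apply/eqP; apply: contraT => cb0.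
case: (@arg_minnP _ b0 (fun b => chi i b v != 0) key cb0) => b cb min_b.
by have := cb; rewrite (v0 b (pivotP YF vF cb min_b)) eqxx.
Qed.

(** Gaussian elimination by descending induction on [key]: a vector with lowest index [b] is
    corrected by the echelon vectors of all later pivots, which do not involve indices below their
    own pivot. *)
Lemma pivot_echelon F i (b : I) : Y F -> b \in C -> vb i b -> exists v,
  [/\ v \in \val F J1 i, forall b', b' \in C -> chi i b' v = (b' == b)%:R &
     forall b', chi i b' v != 0 -> (key b <= key b')%N].
Proof.
move=> YF; pose bd := (\max_b0 key b0)%N.
have: forall d b, (bd < key b + d)%N -> b \in C -> vb i b -> exists v,
  [/\ v \in \val F J1 i, forall b', b' \in C -> chi i b' v = (b' == b)%:R &
     forall b', chi i b' v != 0 -> (key b <= key b')%N]; last first.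
  by move/(_ bd.+1 b); apply; rewrite addnS ltnS leq_addl.
elim=> [b0|d IHd b0 lt b0C vb0].
  by rewrite addn0 ltnNge /bd leq_bigmax.
have wP b' : exists w, [&& b' \in C, vb i b' & (key b0 < key b')%N] ->
  [/\ w \in \val F J1 i, forall b'', b'' \in C -> chi i b'' w = (b'' == b')%:R &
     forall b'', chi i b'' w != 0 -> (key b' <= key b'')%N].
  have [/and3P[b'C vb' lt']|] := boolP [&& _, _ & _]; last by exists 0.
  have [|w wP] := IHd b' _ b'C vb'; last by exists w.
  by apply: leq_trans lt _; rewrite addnS -addSn leq_add2r.
have [w {}wP] := choice wP.
have [u [uF u1 ulow]] := pivot_lead YF b0C vb0.
pose v := u -
  \sum_(b' | [&& b' \in C, vb i b' & (key b0 < key b')%N]) chi i b' u *: w b'.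
exists v; split.
- rewrite memvB // memv_suml // => b' b'P; rewrite memvZ //.
  by have [] := wP b' b'P.
- move=> b' b'C; rewrite linearB linear_sum /=.
  have [b'P|b'P] := boolP [&& b' \in C, vb i b' & (key b0 < key b')%N].
    rewrite (bigD1 b') //= big1 ?addr0 => [|b'' /andP[b''P b''b']].
      rewrite linearZ /=; have [_ -> // _] := wP b' b'P.
      rewrite eqxx [_ *: _]mulr1 subrr; case: eqP b'P => // ->.
      by rewrite ltnn !andbF.
    rewrite linearZ /=; have [_ -> // _] := wP b'' b''P.
    by rewrite eq_sym (negPf b''b') scaler0.
  rewrite big1 ?subr0 => [|b'' b''P]; last first.
    rewrite linearZ /=; have [_ -> // _] := wP b'' b''P.
    by case: eqP b'P => [->|]; rewrite ?b''P ?scaler0.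
  case: eqP => [->//|b'b0]; apply/eqP; apply: contraNT b'P => cb'.
  rewrite b'C (chi_valid cb') ltn_neqAle ulow //= andbT.
  by apply/eqP => /key_inj/esym.
- move=> b'; apply: contraR; rewrite -ltnNge => lt'.
  rewrite linearB linear_sum /= big1 ?subr0 => [|b'' b''P].
    by apply: contraTT lt' => /ulow; rewrite -leqNgt.
  rewrite linearZ /=; have [_ _ low] := wP b'' b''P.
  have -> : chi i b' (w b'') = 0; last by rewrite scaler0.
  apply/eqP; apply: contraTT lt' => /low; rewrite -leqNgt; apply: leq_trans.
  by case/and3P: b''P => _ _ /ltnW.
Qed.

(** The coefficient of [v] at [b] reappears in [rmap M i v] at the successor of [b]. Strict
    stability puts this image in [cspan T], so the successor is in [T] or its vector is 0. *)
Lemma flag_socle F i v (b : I) : fixed_flags j S F -> v \in \val F J1 i ->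
  chi i b v != 0 -> b \notin T -> socle b.
Proof.
move=> FA vF cb bT; have vbi := chi_valid cb; have ci := vb_cl vbi; subst i.
rewrite /socle bT; case/andP: (vbi) => -> _ /=.
apply: e_cspan => b' vb' b1 b2.
have rF : rmap M (cl b) v \in \val F J0 (ordS (cl b)).
  have /subvP := strictly_stable_img (l := J1) (l' := J0) (cl b) FA.1 (leqnn _).
  by apply; rewrite memv_img.
rewrite fixed_flagsT // in rF; move/cspanP/(_ b'): rF; apply.
by rewrite (chi_rmap _ vb' b1 b2).
Qed.

Lemma pivot_socle b : b \in C -> b \notin T -> socle b.
Proof.
move=> bC; have YF0 : Y F0 by [].
have vbi : vb (cl b) b by move: bC; rewrite inE /vb /valid eqxx andbT => /andP[].
have [v [vF vC _]] := pivot_echelon YF0 bC vbi.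
by apply: flag_socle F0A vF _; rewrite vC // eqxx oner_neq0.
Qed.

Lemma cspanT_pivot i b : b \in T -> vb i b -> b \in C.
Proof.
move=> bT vbi; have YF0 : Y F0 by [].
apply: (pivotP (i := i) (v := ee i b) YF0).
- apply: subvP (flag_le F0 i (_ : J0 <= J1)%N) _ _; first exact: leqnSn.
  by rewrite (fixed_flagsT _ F0A) ee_cspan.
- by rewrite chi_ee vbi eqxx oner_neq0.
- move=> b'; rewrite chi_ee; case: (eqVneq b' b) => [->//|_].
  by rewrite andbF eqxx.
Qed.

(** * The Schubert cell as a family of unipotent translates *)

Let g := unip (moving (C := C)).
Let gF := unip_flag (dd := dd) (moving_comp0 (C := C)).

(** Only moves starting at [b] itself act on [ee i b]: if [b] is in [T] every move kills it, and
    otherwise [b] is the only socle element of its string. *)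
Lemma chi_unip_ee y i b b' : b \in C -> vb i b -> chi i b' (g y i (ee i b)) =
  (b' == b)%:R + \sum_(a | enum_val a == (b, b')) y 0 a :> k.
Proof.
move=> bC vbi; rewrite /g unipE linearD linear_sum /= chi_ee.
have -> : vb i b' && (b' == b) = (b' == b).
  by case: eqP => [->|]; rewrite ?vbi ?andbF.
congr (_ + _); rewrite [RHS]big_mkcond; apply: eq_bigr => a _.
rewrite linearZ /=; set p := enum_val a; have pm : p \in moves C by exact: enum_valP.
have /movesP[[p1C p2C s1 s2] [clp _]] := pm.
have [p1b|p1b] := eqVneq p.1 b; last first.
  rewrite (_ : moving a i (ee i b) = 0) ?linear0 ?scaler0.
    by case: eqP => // pE; rewrite pE eqxx in p1b.
  have [bT|bT] := boolP (b \in T); first by rewrite /moving (raise_cspanT pm) ?ee_cspan.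
  rewrite /moving raiseE; last exact: moves_good pm.
  case: ifP => // /andP[/eqP eq1 _].
  by rewrite (socle_inj (pivot_socle bC bT) s1 eq1) eqxx in p1b.
rewrite /moving raiseE -/p; last exact: moves_good pm.
rewrite p1b eqxx leqnn /= subnKC; last first.
  by rewrite -p1b; case: (moves_good pm).
rewrite chi_ee -/(ee i p.2) [p]surjective_pairing /= p1b xpair_eqE eqxx /=.
case: (eqVneq b' p.2) => [->|b'p]; last by rewrite andbF scaler0.
have vp2 : vb i p.2.
  by rewrite /vb /valid -(vb_cl vbi) -p1b clp eqxx andbT; case/and3P: s2.
by rewrite vp2 [_ *: _]mulr1.
Qed.

Lemma chi_unip_pivot y i b b' : b \in C -> vb i b -> b' \in C ->
  chi i b' (g y i (ee i b)) = (b' == b)%:R.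
Proof.
move=> bC vbi b'C; rewrite chi_unip_ee // big1 ?addr0 // => a /eqP aE.
by have /movesP[[_ + _ _] _] := enum_valP a; rewrite aE b'C.
Qed.

Lemma pivot_uniq F i b v w : Y F -> v \in \val F J1 i -> w \in \val F J1 i ->
    (forall b', b' \in C -> chi i b' v = (b' == b)%:R) ->
    (forall b', b' \in C -> chi i b' w = (b' == b)%:R) ->
  v = w.
Proof.
move=> YF vF wF vC wC; apply/eqP; rewrite -subr_eq0; apply/eqP.
apply: (pivot_eq0 YF) => [|b0 b0C]; first exact: memvB.
by rewrite linearB /= vC // wC // subrr.
Qed.

(** The entries of an echelon vector are accounted for by moves. A nonzero entry at a non-pivot [b']
    forces [b'] out of [T], whose indices at [i] are pivots, and forces [b] out of [T], since
    otherwise [v] would be [ee i b]. Both are then in the socle, with [b'] later than [b]. *)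
Lemma unip_pivot F (y : 'rV[k]_#|moves C|) i b v :
    Y F -> b \in C -> vb i b -> v \in \val F J1 i ->
    (forall b', b' \in C -> chi i b' v = (b' == b)%:R) ->
    (forall a, (enum_val a).1 = b -> y 0 a = chi i (enum_val a : I * I).2 v) ->
  g y i (ee i b) = v.
Proof.
move=> YF bC vbi vF vC yE; apply: eq_chi => b'; rewrite chi_unip_ee //.
have [pm|pm] := boolP ((b, b') \in moves C).
  have /movesP[[_ /= b'C _ _] _] := pm.
  rewrite (_ : b' == b = false) ?add0r; last first.
    by apply: contraNF b'C => /eqP->.
  rewrite (bigD1 (enum_rank_in pm (b, b'))) /=; last by rewrite enum_rankK_in.
  rewrite big1 ?addr0 => [|a /andP[/eqP aE /negP[]]]; last first.
    by rewrite -(inj_eq enum_val_inj) aE enum_rankK_in.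
  by rewrite yE enum_rankK_in.
rewrite big1 ?addr0 => [|a /eqP aE]; last by rewrite -aE enum_valP in pm.
have [b'C|b'C] := boolP (b' \in C); first by rewrite vC.
rewrite (_ : b' == b = false); last by apply: contraNF b'C => /eqP->.
apply/esym/eqP; apply: contraT => cb'; case/negP: pm; apply/movesP => /=.
have b'T : b' \notin T by apply: contra b'C => /cspanT_pivot; apply; exact: chi_valid cb'.
have [w [wF wC low]] := pivot_echelon YF bC vbi.
have bT : b \notin T.
  apply: contra cb' => bT; rewrite -(pivot_uniq YF (v := ee i b) _ vF _ vC).
  - rewrite chi_ee; case: (eqVneq b' b) => [b'b|_]; first by rewrite b'b bC in b'C.
    by rewrite andbF.
  - apply: subvP (flag_le F i (_ : J0 <= J1)%N) _ _; first exact: leqnSn.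
    by rewrite (fixed_flagsT _ YF.1) ee_cspan.
  - move=> b0 b0C; rewrite chi_ee; case: (eqVneq b0 b) => [->|_]; last by rewrite andbF.
    by rewrite vbi.
rewrite (pivot_uniq YF wF vF wC vC) in low.
split; [split=> //|split].
- exact: pivot_socle.
- exact: flag_socle YF.1 vF cb' b'T.
- by rewrite (vb_cl vbi) (vb_cl (chi_valid cb')).
- rewrite ltn_neqAle low // andbT; apply/eqP => /key_inj bb'.
  by rewrite -bb' bC in b'C.
Qed.

Lemma flag_unip F y i : Y F ->
    (forall b, b \in C -> vb i b -> g y i (ee i b) \in \val F J1 i) ->
  \val F J1 i = (g y i @: cspan i C)%VS.
Proof.
move=> YF gC; apply/eqP; rewrite eqEsubv; apply/andP; split; last first.
  have /subvP sub : (cspan i C <= g y i @^-1: \val F J1 i)%VS.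
    by apply: cspan_sub => b bC vbi; rewrite -memv_preim gC.
  by apply/subvP => _ /memv_imgP[v /sub + ->]; rewrite -memv_preim.
apply/subvP => v vF.
pose v' := \sum_(b | (b \in C) && vb i b) chi i b v *: g y i (ee i b).
suff -> : v = v'.
  apply: memv_suml => b /andP[bC _].
  by rewrite memvZ // memv_img // ee_cspan.
apply/eqP; rewrite -subr_eq0; apply/eqP; apply: (pivot_eq0 YF) => [|b0 b0C].
  rewrite memvB // memv_suml // => b /andP[bC vbi].
  by rewrite memvZ // gC.
rewrite linearB linear_sum /=.
have [vb0|vb0] := boolP (vb i b0).
  rewrite (bigD1 b0) ?b0C //= big1 ?addr0 => [|b /andP[/andP[bC vbi] bb0]].
    by rewrite linearZ /= chi_unip_pivot // eqxx [_ *: _]mulr1 subrr.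
  by rewrite linearZ /= chi_unip_pivot // eq_sym (negPf bb0) scaler0.
have c0 w : chi i b0 w = 0 by apply/eqP; apply: contraNT vb0; exact: chi_valid.
by rewrite c0 big1 ?subrr // => b _; rewrite linearZ /= c0 scaler0.
Qed.

Lemma dim_cspan i (S' : {set I}) :
  \dim (cspan i S') = #|[set b in S' | vb i b]|.
Proof.
set A := [set b in S' | _]; pose B := [tuple ee i (enum_val a) | a < #|A|].
have AP (a : 'I_#|A|) : enum_val a \in S' /\ vb i (enum_val a).
  by have := enum_valP a; rewrite inE => /andP[].
have BE (a : 'I_#|A|) : B`_a = ee i (enum_val a).
  by rewrite -tnth_nth tnth_mktuple.
have fB : free B.
  apply/freeP => x x0 a; have := congr1 (chi i (enum_val a)) x0.
  rewrite linear0 linear_sum (bigD1 a) //= big1 ?addr0 => [|a' a'a].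
    rewrite linearZ BE /= chi_ee eqxx (AP a).2.
    by rewrite [_ *: _]mulr1.
  rewrite linearZ BE /= chi_ee (inj_eq enum_val_inj).
  by rewrite eq_sym (negPf a'a) andbF scaler0.
rewrite -(size_tuple B) -(eqnP fB); congr (\dim _); apply/eqP.
rewrite eqEsubv; apply/andP; split.
  apply: cspan_sub => b bS vbi; have bA : b \in A by rewrite inE bS.
  apply: memv_span; apply/mapP; exists (enum_rank_in bA b); first by rewrite mem_enum.
  by rewrite enum_rankK_in.
by apply/span_subvP => _ /mapP[a _ ->]; rewrite ee_cspan // (AP a).1.
Qed.


Lemma dim_g y i (U : {vspace V i}) : \dim (g y i @: U) = \dim U.
Proof. exact: (dim_unip (moving_comp0 (C := C))). Qed.

(** A move adds the positive constant [key p.2 - key p.1] to the keys of all basis vectors that it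
    displaces. *)
Lemma unip_upper y i c b : (g y i @: cspan i (upper c b))%VS = cspan i (upper c b).
Proof.
apply/eqP; rewrite eqEdim dim_g leqnn andbT.
suff /subvP sub : (cspan i (upper c b) <= g y i @^-1: cspan i (upper c b))%VS.
  by apply/subvP => _ /memv_imgP[v /sub + ->]; rewrite -memv_preim.
apply: cspan_sub => b0 b0U vb0; rewrite -memv_preim /g unipE.
rewrite memvD ?ee_cspan // memv_suml // => a _; rewrite memvZ // /moving.
have := enum_valP a; set p := enum_val a => pm.
rewrite raiseE; last exact: moves_good pm.
case: ifP => [/andP[/eqP b01 _]|_]; last by rewrite mem0v.
apply: e_cspan => b1 _ b11 b12; move: b0U; rewrite !inE => /leq_trans; apply.
have [_ _ le] := moves_good pm; have /movesP[_ [_ lt]] := pm.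
rewrite /key b11 b12 b01 mulnDl -addnA leq_add2l mulnBl.
rewrite -(leq_add2l (p.1.2 * q)) addnA subnKC ?leq_mul2r ?le ?orbT //.
exact: ltnW.
Qed.

Lemma level_unip y bc F : (forall i, \val F J1 i = (g y i @: cspan i C)%VS) ->
  level bc F = \dim (cspan (cl bc.1) C :&: cspan (cl bc.1) (upper bc.2 bc.1)).
Proof.
move=> FJ; rewrite /level FJ -{1}(unip_upper y) -lker0_img_cap ?dim_g //.
exact: (unip_lker0 (moving_comp0 (C := C))).
Qed.

(** The coordinate [h F] at a move is the entry, at the target of the move, of the echelon vector of
    its source. Echelon vectors are dual to the pivots, so [chart_regular] applies. *)
Lemma slice_paved :
  @paved k (frame V) _ (@frame_coord k n V) _ (frame_flag dd)
    (fixed_flags j.+1 (fun l => if (l <= j)%N then S l else C)) ->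
  @paved k (frame V) _ (@frame_coord k n V) _ (frame_flag dd) Y.
Proof.
pose b_ (a : 'I_#|moves C|) := (enum_val a).1; pose i_ a := cl (b_ a).
have b_C a : b_ a \in C by have /movesP[[]] := enum_valP a.
have b_v a : vb (i_ a) (b_ a).
  rewrite /vb /valid eqxx andbT.
  by have /movesP[[_ _ /and3P[]]] := enum_valP a.
have xP (Fa : X * 'I_#|moves C|) : exists x : k, Y Fa.1 -> exists v,
    [/\ v \in \val Fa.1 J1 (i_ Fa.2),
      forall b', b' \in C -> chi (i_ Fa.2) b' v = (b' == b_ Fa.2)%:R &
      x = chi (i_ Fa.2) (enum_val Fa.2).2 v].
  have [YF|] := pselect (Y Fa.1); last by exists 0.
  have [v [vF vC _]] := pivot_echelon YF (b_C Fa.2) (b_v Fa.2).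
  by exists (chi (i_ Fa.2) (enum_val Fa.2).2 v) => _; exists v.
have [x {}xP] := choice xP.
pose h (F : X) : 'rV[k]_#|moves C| := \row_a x (F, a).
have hP F a v : Y F -> v \in \val F J1 (i_ a) ->
    (forall b', b' \in C -> chi (i_ a) b' v = (b' == b_ a)%:R) ->
    h F 0 a = chi (i_ a) (enum_val a).2 v.
  move=> YF vF vC; have [w [wF wC xE]] := xP (F, a) YF.
  by rewrite mxE xE (pivot_uniq YF wF vF wC vC).
have ghF F : Y F -> forall i, \val F J1 i = (g (h F) i @: cspan i C)%VS.
  move=> YF i; apply: flag_unip => // b bC vbi.
  have [v [vF vC _]] := pivot_echelon YF bC vbi.
  rewrite (unip_pivot YF bC vbi vF vC) // => a ab.
  have ci := vb_cl vbi; subst i b; exact: hP.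
have YF0 : Y F0 by [].
have J1j : (J1 <= j)%N = false by rewrite ltnn.
apply: (@paved_unip k n V dd _ (moving (C := C)) (moving_comp0 (C := C)) Y
  (fixed_flags j.+1 (fun l => if (l <= j)%N then S l else C)) h).
- move=> a; pose Ci := [set b in C | vb (i_ a) b].
  have bCi : b_ a \in Ci by rewrite inE b_C b_v.
  apply: (chart_regular (p := #|Ci|) (theta := fun a' => chi (i_ a) (enum_val a'))
    (xi := chi (i_ a) (enum_val a).2) (b := enum_rank_in bCi (b_ a)) (j := J1)).
  + by rewrite -(dim_flag F0) (ghF _ YF0) dim_g dim_cspan.
  + move=> F YF; have [v [vF vC xE]] := xP (F, a) YF; exists v => //.
    split=> [a'|]; last by rewrite mxE xE.
    have := enum_valP a'; rewrite inE => /andP[a'C _].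
    by rewrite vC // -(inj_eq enum_val_inj) enum_rankK_in.
  + move=> F v YF vF v0; apply: (pivot_eq0 YF vF) => b bC.
    apply/eqP; apply: contraT => cb; have bi : b \in Ci by rewrite inE bC (chi_valid cb).
    have := v0 (enum_rank_in bi b); rewrite enum_rankK_in // => /eqP.
    by rewrite (negPf cb).
- move=> F YF; have [Fs FS] := fixed_flags_unip (C := C) (- h F) YF.1.
  split=> // l i lj; have [lej|gtj] := leqP l j; first exact: FS.
  have -> : l = J1 by apply/val_inj/eqP; rewrite eqn_leq lj.
  rewrite /= (ghF _ YF) -limg_comp (_ : (_ \o _)%VF = \1%VF) ?lim1g //.
  by apply/lfunP => v; rewrite comp_lfunE (unipNK (moving_comp0 (C := C))) id_lfunE.
move=> y F [Fs FS].
have FA : fixed_flags j S F.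
  by split=> // l i lj; rewrite FS ?(leq_trans lj) // lj.
have FJ i : \val F J1 i = cspan i C by rewrite FS ?leqnn // J1j.
have gFJ i : \val (gF y F) J1 i = (g y i @: cspan i C)%VS by rewrite -FJ.
have YgF : Y (gF y F).
  split; first exact: fixed_flags_unip.
  (* Step [J1] of [F0] is itself a translate of [cspan C], so both levels equal that of
     [cspan C]. *)
  by move=> bc; rewrite (level_unip (y := y)) // (level_unip bc (ghF _ YF0)).
split=> //; apply/rowP => a.
rewrite (hP _ a (g y (i_ a) (ee (i_ a) (b_ a))) YgF).
- have /movesP[[_ p2C _ _] _] := enum_valP a.
  rewrite chi_unip_ee // (_ : _ == _ = false) ?add0r; last first.
    by apply: contraNF p2C => /eqP->; exact: b_C.
  rewrite (bigD1 a) /=; last by rewrite -surjective_pairing.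
  rewrite big1 ?addr0 // => a' /andP[/eqP a'E /negP[]].
  by rewrite -(inj_eq enum_val_inj) a'E -surjective_pairing.
- by rewrite gFJ memv_img // ee_cspan.
- by move=> b' b'C; rewrite chi_unip_pivot.
Qed.

End Step.

Lemma fixed_flags_paved t j S : (j + t = m)%N ->
  @paved k (frame V) _ (@frame_coord k n V) _ (frame_flag dd) (fixed_flags j S).
Proof.
elim: t j S => [|t IHt] j S jt.
  apply: paved_singleton; first exact: frame_flag_surj.
  move=> F F' [_ FS] [_ F'S]; apply: val_inj; apply/funext => l.
  apply: functional_extensionality_dep => i.
  by rewrite FS ?F'S //; rewrite addn0 in jt; rewrite jt -ltnS.
have jm : (j < m)%N by rewrite -jt addnS ltnS leq_addr.
apply: (@paved_levels k _ _ _ _ _ _ (level (Ordinal jm))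
  (fun bc => \dim {: V (iter bc.1.2 (@ordS n) (col bc.1.1))}) (enum {: I * bool})).
- by move=> bc r; exact: flag_dim_cap_open.
- by move=> bc F; rewrite dimvS ?subvf.
move=> F0 F0A; have := slice_paved (j := Ordinal jm) F0A.
move/(_ (IHt j.+1 _ _)); rewrite addSnnS => /(_ jt).
rewrite (_ : [set x | forall i, i \in enum _ -> _] =
  [set F | forall bc, level (Ordinal jm) bc F = level (Ordinal jm) bc F0]) //.
apply/seteqP; split=> F /= FF bc; last by move=> _; exact: FF.
by apply: FF; rewrite mem_enum.
Qed.

End CyclicFlags.

Theorem theorem6p3 (p : nat) (k : closedFieldType)
    (iota : {rmorphism 'F_p -> k}) (hk : alg_closure_of_Fp iota)
    (n : nat) (hn : (0 < n)%N) (M : cyclic_rep k n) (hM : nilpotent_rep M)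
    (dd : composition (dimvec (rspace M))) :
  affine_paving (quiver_flag_variety dd).
Proof.
have [q [L [len [col [e [chi /= [lenL rmap_e e_inv chi_e0 e_sum]]]]]]] := jordan_basis hM.
apply: (@paved_affine_paving k (frame (rspace M)) _ (@frame_coord k n (rspace M)) _
  (frame_flag dd)).
have := @fixed_flags_paved k n M dd q L len col e chi lenL rmap_e e_inv chi_e0 e_sum
  (clen dd) 0%N (fun=> finset.set0) (add0n _).
(* For [j = 0] the only prescribed step is the zero subspace, spanned by the empty set. *)
rewrite (_ : fixed_flags _ _ _ = @strictly_stable k n M dd) //.
apply/seteqP; split=> [F []//|F Fs]; split=> // l i; rewrite leqn0 => /eqP l0.
rewrite (_ : l = ord0) ?flag0; last exact: val_inj.
by rewrite /cspan finset.big_set0.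
Qed.
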